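(* For every $k\geq1$ there is $K\geq1$ such that the following holds. Let $\mathcal{H}$ be a hereditary property of $3$-graphs with $k\otimes U(k)\notin\mathrm{Trip}(\mathcal{H})$. Then, asymptotically, $$M^{weak}_{\mathcal{H}}(2\epsilon_1^{1/4K})\leq M^{hom}_{\mathcal{H}}(2\epsilon_1^{1/K})\leq T_{\mathcal{H}}(\epsilon_1,\epsilon_2)\leq M^{hom}_{\mathcal{H}}(\epsilon_1/6).$$
   Context: A $3$-graph is $H=(V,E)$ with $E$ a set of $3$-element subsets of $V$; $\overline{E}=\{(x,y,z)\in V^3:\{x,y,z\}\in E\}$; $d_H(X,Y,Z)=|\overline{E}\cap(X\times Y\times Z)|/(|X||Y||Z|)$. A hereditary property of $3$-graphs is a class of finite $3$-graphs closed under isomorphism and induced sub-$3$-graphs. For a graph $G=(V,E)$, $k\otimes G$ is the $3$-graph on $V\cup C$ ($C$ a new set of $k$ vertices) with edges $\{xyz:xy\in E,z\in C\}$; $U(k)$ is the graph on $\{a_i:i\in[k]\}\cup\{b_S:S\subseteq[k]\}$ with edges $\{a_ib_S:i\in S\}$. For a $3$-graph $H=(V,E)$, $\mathrm{Trip}(H)$ has vertices $\{a_v,b_v,c_v:v\in V\}$ and edges $\{a_vb_{v'}c_{v''}:vv'v''\in E\}$; $\mathrm{Trip}(\mathcal{H})$ is the closure under isomorphism and induced sub-$3$-graphs of $\{\mathrm{Trip}(H):H\in\mathcal{H}\}$. A partition $\mathcal{P}$ of $V$ is $\epsilon$-homogeneous for $H$ if for at least $(1-\epsilon)|V|^3$ triples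 $(x,y,z)$ the triple of parts $(X,Y,Z)$ containing it has $d_H(X,Y,Z)\in[0,\epsilon)\cup(1-\epsilon,1]$. Under the hypothesis on $\mathcal{H}$, it is known that for each $\epsilon\in(0,1)$ all sufficiently large members of $\mathcal{H}$ have $\epsilon$-homogeneous partitions of bounded size; $M^{hom}_{\mathcal{H}}(\epsilon)$ is the least $M$ such that all sufficiently large $H\in\mathcal{H}$ have an $\epsilon$-homogeneous partition with at most $M$ parts. A triple $(X,Y,Z)$ is weakly $\epsilon$-regular for $H$ if $|d_H(X',Y',Z')-d_H(X,Y,Z)|\leq\epsilon$ whenever $X'\subseteq X,Y'\subseteq Y,Z'\subseteq Z$ with $|X'|\geq\epsilon|X|,|Y'|\geq\epsilon|Y|,|Z'|\geq\epsilon|Z|$; a partition is weakly $\epsilon$-regular if at least $(1-\epsilon)|V|^3$ triples $(x,y,z)$ lie in weakly $\epsilon$-regular triples of parts; $M^{weak}_{\mathcal{H}}(\epsilon)$ is the least $M$ such that all sufficiently large $H\in\mathcal{H}$ have weakly $\epsilon$-regular partitions with at most $M$ parts. A bigraph is $B=(U,W;E)$, $E\subseteq U\times W$, density $d_B$; $\mathrm{dev}_2(\epsilon,d)$: $|d_B-d|\leq\epsilon$ and $\sum_{u_0,u_1\in U}\sum_{w_0,w_1\in W}\prod_{i,j\in\{0,1\}}g(u_i,w_j)\leq\epsilon|U|^2|W|^2$, $g=1-d_B$ on $E$, $-d_B$ off $E$; $\mathrm{dev}_2(\epsilon)=\mathrm{dev}_2(\epsilon,d_B)$. A triad $G=(X,Y,Z;E_{XY},E_{XZ},E_{YZ})$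 has $K_3(G)=\{(x,y,z):(x,y)\in E_{XY},(x,z)\in E_{XZ},(y,z)\in E_{YZ}\}$; with $d=|\overline{E}\cap K_3(G)|/|K_3(G)|$, $G$ has $\mathrm{dev}_{2,3}(\epsilon_1,\epsilon_2)$ w.r.t. $H$ if for some $d_{XY},d_{XZ},d_{YZ}>0$ its component bigraphs have $\mathrm{dev}_2(\epsilon_2,d_{XY}),\mathrm{dev}_2(\epsilon_2,d_{XZ}),\mathrm{dev}_2(\epsilon_2,d_{YZ})$ and $\sum_{u_0,u_1\in X}\sum_{w_0,w_1\in Y}\sum_{z_0,z_1\in Z}\prod_{(i,j,k)\in\{0,1\}^3}h(u_i,w_j,z_k)\leq\epsilon_1d_{XY}^4d_{XZ}^4d_{YZ}^4|X|^2|Y|^2|Z|^2$ ($h=1-d$ on $\overline{E}\cap K_3(G)$, $-d$ on $K_3(G)\setminus\overline{E}$, $0$ elsewhere). A $(t,\ell)$-decomposition of $V$: partition $\{V_1,\ldots,V_t\}$ and for each $1\leq i,j\leq t$ a partition $V_i\times V_j=P_{ij}^1\cup\cdots\cup P_{ij}^\ell$, triads $(V_i,V_j,V_k;P_{ij}^\alpha,P_{ik}^\beta,P_{jk}^\gamma)$; it is a $(t,\ell,\epsilon_1,\epsilon_2)$-decomposition if at least $(1-\epsilon_1)|V|^2$ pairs lie in parts $P_{ij}^\alpha$ with $(V_i,V_j;P_{ij}^\alpha)$ having $\mathrm{dev}_2(\epsilon_2)$, and $\mathrm{dev}_{2,3}(\epsilon_1,\epsilon_2)$-regular w.r.t. $H$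 if all but at most $\epsilon_1|V|^3$ triples $(x,y,z)$ lie in $K_3(G)$ for a triad $G$ having $\mathrm{dev}_{2,3}(\epsilon_1,\epsilon_2)$ w.r.t. $H$. $T_{\mathcal{H}}(\epsilon_1,\epsilon_2)$ is the least $T$ for which there are $L,n_0$ such that every $H\in\mathcal{H}$ on at least $n_0$ vertices has, for some $t\leq T$, $\ell\leq L$, a $(t,\ell,\epsilon_1,\epsilon_2(\ell))$-decomposition that is $\mathrm{dev}_{2,3}(\epsilon_1,\epsilon_2(\ell))$-regular w.r.t. $H$. ''Asymptotically, $P(\epsilon_1,\epsilon_2)$'' means: there is $\epsilon^*>0$ such that for every $0<\epsilon_1<\epsilon^*$ there is $\epsilon_2^{(\epsilon_1)}:\mathbb{N}\to(0,1]$ with $P(\epsilon_1,\epsilon_2)$ holding for every $\epsilon_2\leq\epsilon_2^{(\epsilon_1)}$ pointwise. *)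

(* Defs.v *)
From mathcomp Require Import all_boot all_order all_algebra.
From mathcomp Require Import boolp reals constructive_ereal ereal exp.

Set Implicit Arguments.
Unset Strict Implicit.
Unset Printing Implicit Defensive.

Import Order.TTheory GRing.Theory Num.Theory.

(** * Graphs, 3-graphs and hereditary properties *)

Record graph2 := Graph2 {
  vert2 :> finType;
  edge2 : {set {set vert2}};
  edge2_card : forall e, e \in edge2 -> #|e| = 2 }.

Record graph3 := Graph3 {
  vert3 :> finType;
  edge3 : {set {set vert3}};
  edge3_card : forall e, e \in edge3 -> #|e| = 3 }.

Definition iso3 (G H : graph3) : Prop :=
  exists2 f : G -> H, bijective f &
    forall e : {set G}, (f @: e \in edge3 H) = (e \in edge3 G).

Lemma induced3_card (H : graph3) (A : {set H}) (e : {set {x : H | x \in A}}) :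
  e \in [set e : {set {x : H | x \in A}} | val @: e \in edge3 H] -> #|e| = 3.
Proof. by rewrite inE => /edge3_card <-; rewrite card_imset //; exact: val_inj. Qed.

Definition induced3 (H : graph3) (A : {set H}) : graph3 :=
  Graph3 (@induced3_card H A).

Definition hereditary (P : graph3 -> Prop) : Prop :=
  (forall G H, iso3 G H -> P G -> P H) /\
  (forall (G : graph3) (A : {set G}), P G -> P (induced3 A)).

(* The smallest hereditary property containing C. *)
Definition hereditary_closure (C : graph3 -> Prop) (G : graph3) : Prop :=
  forall P : graph3 -> Prop, hereditary P -> (forall F, C F -> P F) -> P G.

(** * The constructions k (x) G, U(k) and Trip *)

Lemma otimes_card (k : nat) (G : graph2) (e : {set G + 'I_k}) :
  e \in [set inr z |: inl @: xy | xy : {set G} in edge2 G, z : 'I_k in [set: 'I_k]] ->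
  #|e| = 3.
Proof.
case/imset2P=> xy z exy _ ->; rewrite cardsU1 card_imset; last by move=> ? ? [].
rewrite (edge2_card exy); case: imsetP => //.
by case.
Qed.

Definition otimes (k : nat) (G : graph2) : graph3 := Graph3 (@otimes_card k G).

Lemma Ugraph_card (k : nat) (e : {set 'I_k + {set 'I_k}}) :
  e \in [set [set inl p.1; inr p.2] |
           p in [set p : 'I_k * {set 'I_k} | p.1 \in p.2]] ->
  #|e| = 2.
Proof. by case/imsetP=> p _ ->; rewrite cards2. Qed.

Definition Ugraph (k : nat) : graph2 := Graph2 (@Ugraph_card k).

(* The ordered triples (x, y, z) whose underlying set is an edge; x, y and z are
   then distinct, since edges have three elements. *)
Definition oedge3 (H : graph3) : {set H * H * H} :=
  [set p | [set p.1.1; p.1.2; p.2] \in edge3 H].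

Definition trip_a (V : finType) (v : V) : V + V + V := inl (inl v).
Definition trip_b (V : finType) (v : V) : V + V + V := inl (inr v).
Definition trip_c (V : finType) (v : V) : V + V + V := inr v.

Lemma trip_card (H : graph3) (e : {set H + H + H}) :
  e \in [set [set trip_a p.1.1; trip_b p.1.2; trip_c p.2] | p in oedge3 H] ->
  #|e| = 3.
Proof.
by case/imsetP=> p _ ->; rewrite setUC cardsU1 cards2 !inE.
Qed.

Definition trip (H : graph3) : graph3 := Graph3 (@trip_card H).

Definition Trip (P : graph3 -> Prop) : graph3 -> Prop :=
  hereditary_closure (fun G => exists2 H, P H & G = trip H).

Local Open Scope ring_scope.

(** * Homogeneous and weakly regular partitions *)

Definition dens3 (R : realType) (H : graph3) (X Y Z : {set H}) : R :=
  #|oedge3 H :&: setX (setX X Y) Z|%:R / (#|X|%:R * #|Y|%:R * #|Z|%:R).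

Definition near01 (R : realType) (eps d : R) : bool :=
  (d \in `[0, eps[) || (d \in `]1 - eps, 1]).

Definition homogeneous (R : realType) (eps : R) (H : graph3)
    (P : {set {set H}}) : bool :=
  (1 - eps) * #|H|%:R ^+ 3 <=
  #|[set p : H * H * H |
      near01 eps (dens3 R (pblock P p.1.1) (pblock P p.1.2) (pblock P p.2))]|%:R.

Definition weakly_regular3 (R : realType) (eps : R) (H : graph3)
    (X Y Z : {set H}) : bool :=
  [forall X' : {set H}, forall Y' : {set H}, forall Z' : {set H},
    [&& X' \subset X, Y' \subset Y, Z' \subset Z,
        eps * #|X|%:R <= #|X'|%:R, eps * #|Y|%:R <= #|Y'|%:R
      & eps * #|Z|%:R <= #|Z'|%:R] ==>
    (`|dens3 R X' Y' Z' - dens3 R X Y Z| <= eps)].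

Definition weakly_regular (R : realType) (eps : R) (H : graph3)
    (P : {set {set H}}) : bool :=
  (1 - eps) * #|H|%:R ^+ 3 <=
  #|[set p : H * H * H |
      weakly_regular3 eps (pblock P p.1.1) (pblock P p.1.2) (pblock P p.2)]|%:R.

(* The least natural number satisfying Q, with the convention that it is +oo when
   there is none. *)
Definition least (R : realType) (Q : nat -> Prop) : \bar R :=
  ereal_inf (fun x : \bar R => exists2 M : nat, Q M & x = (M%:R)%:E).

Definition Mhom (R : realType) (P : graph3 -> Prop) (eps : R) : \bar R :=
  least R (fun M => exists n0 : nat, forall H : graph3, P H -> (n0 <= #|H|)%N ->
    exists Q : {set {set H}},
      [/\ partition Q [set: H], (#|Q| <= M)%N & homogeneous eps Q]).

Definition Mweak (R : realType) (P : graph3 -> Prop) (eps : R) : \bar R :=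
  least R (fun M => exists n0 : nat, forall H : graph3, P H -> (n0 <= #|H|)%N ->
    exists Q : {set {set H}},
      [/\ partition Q [set: H], (#|Q| <= M)%N & weakly_regular eps Q]).

(** * Quasirandom bigraphs and triads *)

(* Both vertex classes of a bigraph, and the three classes of a triad, are subsets
   of an ambient finite type V; they need not be disjoint. *)
Record bigraph (V : finType) := Bigraph {
  bleft : {set V};
  bright : {set V};
  bedge : {set V * V};
  bedge_sub : bedge \subset setX bleft bright }.

Definition dens2 (R : realType) (V : finType) (B : bigraph V) : R :=
  #|bedge B|%:R / (#|bleft B|%:R * #|bright B|%:R).

Definition balanced2 (R : realType) (V : finType) (B : bigraph V) (u w : V) : R :=
  if (u, w) \in bedge B then 1 - dens2 R B else - dens2 R B.

Definition dev2_wrt (R : realType) (V : finType) (eps d : R) (B : bigraph V) : Prop :=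
  `|dens2 R B - d| <= eps /\
  \sum_(u0 in bleft B) \sum_(u1 in bleft B)
  \sum_(w0 in bright B) \sum_(w1 in bright B)
    \prod_(i : bool) \prod_(j : bool)
      balanced2 R B (if i then u1 else u0) (if j then w1 else w0)
  <= eps * #|bleft B|%:R ^+ 2 * #|bright B|%:R ^+ 2.

Definition dev2 (R : realType) (V : finType) (eps : R) (B : bigraph V) : Prop :=
  dev2_wrt eps (dens2 R B) B.

Record triad (V : finType) := Triad {
  tX : {set V};
  tY : {set V};
  tZ : {set V};
  tXY : {set V * V};
  tXZ : {set V * V};
  tYZ : {set V * V};
  tXY_sub : tXY \subset setX tX tY;
  tXZ_sub : tXZ \subset setX tX tZ;
  tYZ_sub : tYZ \subset setX tY tZ }.

Definition bigraphXY (V : finType) (G : triad V) := Bigraph (tXY_sub G).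
Definition bigraphXZ (V : finType) (G : triad V) := Bigraph (tXZ_sub G).
Definition bigraphYZ (V : finType) (G : triad V) := Bigraph (tYZ_sub G).

Definition K3 (V : finType) (G : triad V) : {set V * V * V} :=
  [set p | [&& (p.1.1, p.1.2) \in tXY G, (p.1.1, p.2) \in tXZ G
             & (p.1.2, p.2) \in tYZ G]].

Definition tdens (R : realType) (H : graph3) (G : triad H) : R :=
  #|oedge3 H :&: K3 G|%:R / #|K3 G|%:R.

Definition balanced3 (R : realType) (H : graph3) (G : triad H) (x y z : H) : R :=
  if (x, y, z) \in oedge3 H :&: K3 G then 1 - tdens R G
  else if (x, y, z) \in K3 G then - tdens R G
  else 0.

Definition dev23 (R : realType) (eps1 eps2 : R) (H : graph3) (G : triad H) : Prop :=
  exists dXY dXZ dYZ : R,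
    [/\ [/\ 0 < dXY, 0 < dXZ & 0 < dYZ],
        [/\ dev2_wrt eps2 dXY (bigraphXY G), dev2_wrt eps2 dXZ (bigraphXZ G)
          & dev2_wrt eps2 dYZ (bigraphYZ G)]
      & \sum_(u0 in tX G) \sum_(u1 in tX G)
        \sum_(w0 in tY G) \sum_(w1 in tY G)
        \sum_(z0 in tZ G) \sum_(z1 in tZ G)
          \prod_(i : bool) \prod_(j : bool) \prod_(k : bool)
            balanced3 R G (if i then u1 else u0) (if j then w1 else w0)
                          (if k then z1 else z0)
        <= eps1 * dXY ^+ 4 * dXZ ^+ 4 * dYZ ^+ 4
           * #|tX G|%:R ^+ 2 * #|tY G|%:R ^+ 2 * #|tZ G|%:R ^+ 2].

(** * Decompositions *)

(* The parts V_i are nonempty, as in any partition.  For each ordered pair (i, j)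
   the sets P_ij^a, a < l, are pairwise disjoint with union V_i x V_j; some of them
   may be empty, since the same l is used for every (i, j) however small
   V_i x V_j is. *)
Record decomposition (V : finType) (t l : nat) := Decomposition {
  vpart : 'I_t -> {set V};
  epart : 'I_t -> 'I_t -> 'I_l -> {set V * V};
  vpart_inj : injective vpart;
  vpart_partition : partition [set vpart i | i : 'I_t] [set: V];
  epart_disj : forall i j a b, a != b -> [disjoint epart i j a & epart i j b];
  epart_cover : forall i j, \bigcup_(a < l) epart i j a = setX (vpart i) (vpart j) }.

Lemma epart_sub (V : finType) (t l : nat) (D : decomposition V t l) i j a :
  epart D i j a \subset setX (vpart D i) (vpart D j).
Proof. by rewrite -epart_cover; apply: bigcup_sup. Qed.

Definition dbigraph (V : finType) (t l : nat) (D : decomposition V t l) i j a :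
  bigraph V := Bigraph (epart_sub D i j a).

Definition dtriad (V : finType) (t l : nat) (D : decomposition V t l)
    i j k a b c : triad V :=
  Triad (epart_sub D i j a) (epart_sub D i k b) (epart_sub D j k c).

Definition regular_pairs (R : realType) (V : finType) (t l : nat) (eps1 eps2 : R)
    (D : decomposition V t l) : Prop :=
  (1 - eps1) * #|V|%:R ^+ 2 <=
  #|[set p : V * V |
      `[< exists i j a, p \in epart D i j a /\ dev2 eps2 (dbigraph D i j a) >]]|%:R.

Definition regular_triples (R : realType) (H : graph3) (t l : nat) (eps1 eps2 : R)
    (D : decomposition H t l) : Prop :=
  #|~: [set p : H * H * H |
      `[< exists i j k a b c,
            p \in K3 (dtriad D i j k a b c) /\
            dev23 eps1 eps2 (dtriad D i j k a b c) >]]|%:R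
  <= eps1 * #|H|%:R ^+ 3.

Definition Tdev23 (R : realType) (P : graph3 -> Prop) (eps1 : R) (eps2 : nat -> R) :
    \bar R :=
  least R (fun T => exists L n0 : nat,
    forall H : graph3, P H -> (n0 <= #|H|)%N ->
      exists t l : nat, [/\ (t <= T)%N, (l <= L)%N &
        exists D : decomposition H t l,
          regular_pairs eps1 (eps2 l) D /\ regular_triples eps1 (eps2 l) D]).

Definition asymptotically (R : realType) (Q : R -> (nat -> R) -> Prop) : Prop :=
  exists2 epsstar : R, 0 < epsstar &
    forall eps1 : R, 0 < eps1 < epsstar ->
      exists2 eps2max : nat -> R, (forall l, 0 < eps2max l <= 1) &
        forall eps2 : nat -> R,
          (forall l, 0 < eps2 l <= 1) -> (forall l, eps2 l <= eps2max l) ->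
          Q eps1 eps2.

(* Main.v *)
Require Import Defs.
From mathcomp Require Import all_boot all_order all_algebra.
From mathcomp Require Import boolp reals constructive_ereal ereal exp.
From mathcomp Require Import zify ring lra.

(* Excluding k (x) U(k) from Trip(P) means that no U(k) is shared by k slices
   f(., ., z) of a member f of P, so all but boundedly many slices contain few copies
   of U(k).  By sampling and the Sauer-Shelah lemma such a slice is, up to an error
   1/u, a union of poly(u) combinatorial boxes; hence multiplication by a slice
   preserves smallness in the cut norm.  This is used twice on a regular triad.
   First, the three quasirandom bigraphs can be replaced by their densities in the
   octahedral sum (qualitatively, at a scale depending on l), which leaves a small
   octahedral sum for f - d on the full box V_i x V_j x V_k.  Second, a typical slice
   of f then correlates little with f - d, which forces d (1 - d) to be at most a
   power of eps1.  So the vertex partition of a regular decomposition is homogeneous.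
   Conversely, a homogeneous partition with complete bigraphs (l = 1) is a regular
   decomposition, and a homogeneous triple of parts is weakly regular because passing
   to large subsets multiplies the density of the rare colour by a bounded factor. *)

Set Implicit Arguments.
Unset Strict Implicit.
Unset Printing Implicit Defensive.
Import Order.TTheory GRing.Theory Num.Theory.

(** * Sauer-Shelah and sampling *)

(** Only one of the two uses of boxes has to be quantitative. Removing the bigraphs loses a factor
    that depends on [l] and on their densities, which may be as small as eps1 / l; this loss is
    charged to eps2, which is chosen after eps1 and as a function of [l], so a qualitative estimate
    suffices. In the second use the number of boxes must be polynomial in the accuracy, because d (1
    - d) has to be bounded by a power of eps1 whose exponent depends on [k] alone. This is why
    Sauer-Shelah is applied instead of counting all traces of a sample, whose number is exponential.
    The bad slices are bounded in number but otherwise arbitrary, so they are negligible only in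
    large parts; hence the thresholds [n0], and hence vertices in small parts are discarded. The
    three parts of a triad may coincide, so a copy of k (x) U(k) found across them need not be an
    induced copy in the 3-graph itself. Passing to [Trip], which triples every vertex, makes the
    hypothesis apply to such copies. *)

Definition shatters (T : finType) (F : {set {set T}}) (S : {set T}) : bool :=
  [forall U : {set T}, (U \subset S) ==> [exists A in F, A :&: S == U]].

Lemma shattersP (T : finType) (F : {set {set T}}) (S : {set T}) :
  reflect (forall U : {set T}, U \subset S -> exists2 A, A \in F & A :&: S = U) (shatters F S).
Proof.
apply: (iffP forallP) => h U; last first.
  by apply/implyP => /h[A AF /eqP AU]; apply/existsP; exists A; rewrite AF.
by move/implyP: (h U) => {}h /h/existsP[A /andP[AF /eqP]]; exists A.
Qed.

(* Pajor's form of the Sauer-Shelah lemma. *)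
Lemma card_le_shattered (T : finType) (F : {set {set T}}) :
  (#|F| <= #|[set S | shatters F S]|)%N.
Proof.
have [n] := ubnP #|F|; elim: n F => // n IHn F /ltnSE le_n.
have [/eqP F0|] := posnP #|F|; first by rewrite leq_eqVlt eq_sym (eqP F0) lt0n eq_sym orbN.
move=> F_gt0; have [F1|] := leqP #|F| 1.
  have /cards1P[A FA] : #|F| == 1 by rewrite eqn_leq F1.
  apply: leq_trans F1 _; apply/card_gt0P; exists set0; rewrite inE.
  by apply/shattersP => U; rewrite subset0 => /eqP ->; exists A; rewrite ?FA ?inE ?setI0.
case/card_gt1P=> A [B [AF BF neqAB]].
have [x xAB] : exists x, (x \in A) != (x \in B).
  apply/existsP; apply: contraNT neqAB; rewrite negb_exists => /forallP h.
  by apply/eqP/setP => x; move: (h x); rewrite negbK => /eqP.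
pose F1 := [set C in F | x \in C]; pose F0 := [set C in F | x \notin C].
have FE : #|F| = (#|F1| + #|F0|)%N.
  rewrite -(cardsID [set C : {set T} | x \in C]) /F1 /F0; congr (_ + _)%N.
    by apply: eq_card => C; rewrite !inE.
  by apply: eq_card => C; rewrite !inE andbC.
have ltF : (0 < #|F1|)%N /\ (0 < #|F0|)%N.
  move: xAB; case xA: (x \in A); case xB: (x \in B) => // _.
    by split; apply/card_gt0P; [exists A|exists B]; rewrite !inE ?AF ?BF ?xA ?xB.
  by split; apply/card_gt0P; [exists B|exists A]; rewrite !inE ?AF ?BF ?xA ?xB.
have {}IH1 : (#|F1| <= #|[set S | shatters F1 S]|)%N by apply: IHn; lia.
have {}IH0 : (#|F0| <= #|[set S | shatters F0 S]|)%N by apply: IHn; lia.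
rewrite FE; apply: leq_trans (leq_add IH1 IH0) _.
set S1 := [set S | _]; set S0 := [set S | _].
have nx1 S : S \in S1 -> x \notin S.
  rewrite inE => /shattersP/(_ set0 (sub0set _))[C]; rewrite inE => /andP[_ xC] CS.
  by apply/negP => xS; have := in_set0 x; rewrite -CS inE xC xS.
have nx0 S : S \in S0 -> x \notin S.
  rewrite inE => /shattersP/(_ S (subxx _))[C]; rewrite inE => /andP[_ xC] CS.
  by apply: contra xC => xS; move: xS; rewrite -CS inE => /andP[].
have sub1 : S1 \subset [set S | shatters F S].
  apply/subsetP => S; rewrite !inE => /shattersP h; apply/shattersP => U /h[C].
  by rewrite inE => /andP[]; exists C.
have sub0 : S0 \subset [set S | shatters F S].
  apply/subsetP => S; rewrite !inE => /shattersP h; apply/shattersP => U /h[C].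
  by rewrite inE => /andP[]; exists C.
(* A set [S] shattered by both halves is counted twice. The second count is charged to [x |: S],
   which [F] shatters: a subset [U] is traced out by a member of [F1] or of [F0] according to
   whether it contains [x]. *)
have injx : {in S1 :&: S0 &, injective (fun S => x |: S)}.
  move=> S S'; rewrite !in_setI => /andP[/nx1 xS _] /andP[/nx1 xS' _] eqS.
  by rewrite -(setU1K xS) -(setU1K xS') eqS.
rewrite -cardsUI -(card_in_imset injx) -cardsUI.
rewrite [X in (_ + X)%N]eq_card0 ?addn0; last first.
  move=> S; rewrite inE; apply/negP => /andP[+ /imsetP[S' _ SE]].
  rewrite inE => /orP[/nx1|/nx0]; by rewrite SE setU11.
apply: subset_leq_card; rewrite !subUset sub1 sub0 /=.
apply/subsetP => _ /imsetP[S /setIP[S1S S0S] ->]; rewrite inE; apply/shattersP => U subU.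
have xS := nx1 _ S1S.
have subU' : U :\ x \subset S by rewrite subDset.
have [xU|xU] := boolP (x \in U).
  move: S1S; rewrite inE => /shattersP/(_ _ subU')[C]; rewrite inE => /andP[CF xC] CS.
  exists C => //; apply/setP => y; move/setP/(_ y): CS; rewrite !inE.
  by case: (eqVneq y x) => [->|]; rewrite ?xC ?xU.
move: S0S; rewrite inE => /shattersP/(_ _ subU')[C]; rewrite inE => /andP[CF xC] CS.
exists C => //; apply/setP => y; move/setP/(_ y): CS; rewrite !inE.
by case: (eqVneq y x) => [->|]; rewrite ?(negPf xC) ?(negPf xU).
Qed.

Lemma card_small_sets (T : finType) (k : nat) :
  (#|[set S : {set T} | #|S| <= k]| <= #|T|.+1 ^ k)%N.
Proof.
(* A set of at most k elements is the set of values of a map from ['I_k] to [option T]; padding with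
   [None] accounts for the successor in the bound. *)
pose im (g : {ffun 'I_k -> option T}) := [set x | Some x \in codom g].
apply: (@leq_trans #|[set im g | g : {ffun 'I_k -> option T}]|); last first.
  by apply: leq_trans (leq_imset_card _ _) _; rewrite card_ffun card_option card_ord.
apply: subset_leq_card; apply/subsetP => S; rewrite inE => Sk.
apply/imsetP; exists [ffun i : 'I_k => onth (enum S) i] => //.
apply/setP => x; rewrite inE; apply/idP/codomP => [xS|[i]].
  have ik : (index x (enum S) < k)%N.
    by apply: leq_trans Sk; rewrite cardE index_mem mem_enum.
  exists (Ordinal ik); rewrite ffunE /= onthE (nth_map x) ?nth_index ?mem_enum //.
  by rewrite index_mem mem_enum.
by rewrite ffunE => iS; rewrite -mem_enum; apply/onthP; exists i.
Qed.

Lemma sauer_shelah (T : finType) (F : {set {set T}}) (k : nat) :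
  (forall S, shatters F S -> (#|S| <= k)%N) -> (#|F| <= #|T|.+1 ^ k)%N.
Proof.
move=> h; apply: leq_trans (card_le_shattered F) _.
apply: leq_trans (card_small_sets T k); apply: subset_leq_card.
by apply/subsetP => S; rewrite !inE => /h.
Qed.

Definition shatter_ext (k : nat) (X Y : finType) (f : X -> Y -> bool)
    (a : {ffun 'I_k -> X}) : {set {ffun {set 'I_k} -> Y}} :=
  [set b : {ffun {set 'I_k} -> Y} | [forall i, forall S, f (a i) (b S) == (i \in S)]].

(* The pairs (a, b) with b in shatter_ext f a are the copies of U(k) in f; nip k N says
   that they have density at most 1/N. *)
Definition nip (k N : nat) (X Y : finType) (f : X -> Y -> bool) : bool :=
  (N * \sum_(a : {ffun 'I_k -> X}) #|shatter_ext f a| <= #|X| ^ k * #|Y| ^ 2 ^ k)%N.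

Definition trace (s : nat) (X Y : finType) (f : X -> Y -> bool)
    (x : {ffun 'I_s -> X}) (y : Y) : {set 'I_s} := [set i | f (x i) y].

Definition trace_class (s : nat) (X Y : finType) (f : X -> Y -> bool)
    (x : {ffun 'I_s -> X}) (T : {set 'I_s}) : {set Y} := [set y | trace f x y == T].

(** Traces with a small class are left out so that shattering yields many copies of U(k) and not
    just one; only a positive density of copies contradicts [nip]. *)
Definition popular (s w : nat) (X Y : finType) (f : X -> Y -> bool)
    (x : {ffun 'I_s -> X}) : {set {set 'I_s}} :=
  [set T | (#|Y| <= w * #|trace_class f x T|)%N].

Definition far_pairs (s u : nat) (X Y : finType) (f : X -> Y -> bool)
    (x : {ffun 'I_s -> X}) : {set Y * Y} :=
  [set p | (#|X| < u * #|[set x | f x p.1 != f x p.2]|)%N &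
           trace f x p.1 == trace f x p.2].

Lemma card_sets_ord (n : nat) : #|{set 'I_n}| = (2 ^ n)%N.
Proof. by have := card_powerset [set: 'I_n]; rewrite powersetT !cardsT card_ord. Qed.

(** Each subset of the k chosen points is cut out by a popular trace. The vertices b_U can be chosen
    independently in the classes of these traces, and every class contains at least |Y| / w
    vertices. *)
Lemma popular_shatter_ext (k s w : nat) (X Y : finType) (f : X -> Y -> bool)
    (x : {ffun 'I_s -> X}) (S : {set 'I_s}) (j : 'I_k -> 'I_s) :
  injective j -> (forall i, j i \in S) -> shatters (popular w f x) S ->
  (#|Y| ^ 2 ^ k <= w ^ 2 ^ k * #|shatter_ext f [ffun i => x (j i)]|)%N.
Proof.
move=> jinj jS /shattersP sh.
have hT (U : {set 'I_k}) : exists T, (T \in popular w f x) && (T :&: S == j @: U).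
  have [|T Tp TS] := sh (j @: U); last by exists T; rewrite Tp TS /=.
  by apply/subsetP => _ /imsetP[i _ ->].
pose T U := xchoose (hT U).
have TP U : #|Y| <= w * #|trace_class f x (T U)|.
  by have /andP[] := xchooseP (hT U); rewrite inE.
have TS U i : (j i \in T U) = (i \in U).
  have /andP[_ /eqP/setP/(_ (j i))] := xchooseP (hT U).
  by rewrite inE jS andbT (mem_imset _ _ jinj).
rewrite -(card_sets_ord k).
have expE n : (n ^ #|{set 'I_k}| = \prod_(U : {set 'I_k}) n)%N.
  by rewrite prod_nat_const.
rewrite !expE.
apply: (@leq_trans (\prod_(U : {set 'I_k}) (w * #|trace_class f x (T U)|))%N).
  exact: leq_prod.
rewrite big_split leq_mul2l; apply/orP; right.
apply: (@leq_trans #|(family (fun U => mem (trace_class f x (T U))) : simpl_pred {ffun {set 'I_k} -> Y})|).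
  by rewrite card_family foldrE big_map big_enum /=.
apply: subset_leq_card; apply/subsetP => b /familyP h; rewrite inE.
apply/forallP => i; apply/forallP => U; move: (h U).
by rewrite !inE => /eqP/setP/(_ (j i)); rewrite inE TS ffunE => ->.
Qed.

(** A k-tuple extends to at most |X|^(s-k) samples that agree with it along [j], since k coordinates
    are forced. Averages over samples thus reduce to averages over k-tuples. *)
Lemma sum_restrict (k s : nat) (X : finType) (j : 'I_k -> 'I_s)
    (h : {ffun 'I_k -> X} -> nat) :
  injective j ->
  (\sum_(x : {ffun 'I_s -> X}) h [ffun i => x (j i)] <=
   #|X| ^ (s - k) * \sum_(a : {ffun 'I_k -> X}) h a)%N.
Proof.
move=> jinj.
rewrite (partition_big (fun x : {ffun 'I_s -> X} => [ffun i => x (j i)]) predT) //=.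
rewrite big_distrr /=; apply: leq_sum => a _.
under eq_bigr => x /eqP -> do [].
rewrite sum_nat_const leq_mul2r; apply/orP; right.
pose F (i : 'I_s) : pred X := [pred z | [forall u, (j u == i) ==> (a u == z)]].
apply: (@leq_trans #|(family F : simpl_pred {ffun 'I_s -> X})|).
  apply: subset_leq_card; apply/subsetP => x; move=> /(_ =P a) xa; apply/familyP => i.
  by rewrite inE; apply/forallP => u; apply/implyP => /eqP <-; rewrite -xa ffunE.
rewrite card_family foldrE big_map big_enum /=.
rewrite (bigID (mem (j @: setT))) /= -[X in (_ <= X)%N]mul1n -[X in (_ <= X * _)%N](exp1n k).
have cJ : #|j @: setT| = k by rewrite card_imset // cardsT card_ord.
apply: leq_mul.
  rewrite (_ : 1 ^ k = \prod_(i in j @: setT) 1)%N; last by rewrite prod_nat_const !exp1n.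
  apply: leq_prod => _ /imsetP[u _ ->].
  rewrite -(card1 (a u)); apply: subset_leq_card; apply/subsetP => z.
  by rewrite !inE => /forallP/(_ u); rewrite eqxx /= eq_sym.
apply: (@leq_trans (\prod_(i in ~: (j @: setT)) #|X|)%N).
  under [leqRHS]eq_bigl => i do rewrite inE.
  by apply: leq_prod => i _; apply: max_card.
by rewrite prod_nat_const cardsCs setCK cJ card_ord.
Qed.

Lemma sample_agree (s : nat) (X Y : finType) (f : X -> Y -> bool) (y y' : Y) :
  #|[set x : {ffun 'I_s -> X} | trace f x y == trace f x y']| =
  (#|[set x | f x y == f x y']| ^ s)%N.
Proof.
rewrite -[in RHS](card_ord s) -card_ffun_on; apply: eq_card => x; rewrite inE.
apply/eqP/ffun_onP => [e i|e]; first by rewrite inE; have /setP/(_ i) := e; rewrite !inE => ->.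
by apply/setP => i; rewrite !inE; have := e i; rewrite inE => /eqP.
Qed.

(** This is (1 - 1/u)^(un) <= 2^-n for u = v + 1, cleared of denominators. It follows from
    Bernoulli's inequality in the form (1 + 1/v)^(v+1) >= 2. *)
Lemma expn_pred_double (v n : nat) : (2 ^ n * v ^ (v.+1 * n) <= v.+1 ^ (v.+1 * n))%N.
Proof.
have bern m : (v ^ m.+1 + m.+1 * v ^ m <= v.+1 ^ m.+1)%N.
  elim: m => [|m IH]; first by rewrite !expn1 expn0; lia.
  rewrite (expnS v.+1); apply: leq_trans (leq_mul (leqnn v.+1) IH).
  by rewrite !expnS; nia.
rewrite !expnM -expnMn; case: n => // n; rewrite leq_exp2r //.
by have := bern v; rewrite !expnS; nia.
Qed.

(** A first-moment argument over random samples of size un. By Markov at most half of them leave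
    more than twice |Y|^2 / 2^n far pairs unseparated, this being twice the bound on the mean.
    Strictly fewer than half contain k distinct positions carrying many copies of U(k), by the size
    of [N]. A sample outside both families is as required. *)
Lemma sampling (k N u v w n : nat) (X Y : finType) (f : X -> Y -> bool) :
  u = v.+1 -> (0 < v)%N -> (2 * (u * n) ^ k * w ^ 2 ^ k < N)%N ->
  (0 < #|X|)%N -> (0 < #|Y|)%N -> nip k N f ->
  exists x : {ffun 'I_(u * n) -> X},
    (forall S, shatters (popular w f x) S -> (#|S| <= k)%N) /\
    (#|far_pairs u f x| * 2 ^ n <= 2 * #|Y| ^ 2)%N.
Proof.
move=> uv v0; set s := (u * n)%N => hN X0 Y0 hnip.
pose res (x : {ffun 'I_s -> X}) (j : {ffun 'I_k -> 'I_s}) : {ffun 'I_k -> X} :=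
  [ffun i => x (j i)].
pose bad2 := [set x : {ffun 'I_s -> X} | [exists j : {ffun 'I_k -> 'I_s},
   injectiveb j && (#|Y| ^ 2 ^ k <= w ^ 2 ^ k * #|shatter_ext f (res x j)|)%N]].
pose bad1 := [set x : {ffun 'I_s -> X} | (2 * #|Y| ^ 2 < #|far_pairs u f x| * 2 ^ n)%N].
have XS : (0 < #|X| ^ s)%N by rewrite expn_gt0 X0.
have b1 : (2 * #|bad1| <= #|X| ^ s)%N.
  have h1 : (#|bad1| * (2 * #|Y| ^ 2) <= \sum_(x : {ffun 'I_s -> X}) #|far_pairs u f x| * 2 ^ n)%N.
    rewrite -sum_nat_const [leqRHS](bigID (mem bad1)) /=.
    by apply: leq_trans (leq_addr _ _); apply: leq_sum => x; rewrite inE => /ltnW.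
  have h2 : (\sum_(x : {ffun 'I_s -> X}) #|far_pairs u f x| * 2 ^ n <= #|Y| ^ 2 * #|X| ^ s)%N.
    rewrite -big_distrl /=.
    have -> : (\sum_(x : {ffun 'I_s -> X}) #|far_pairs u f x| =
       \sum_(p : Y * Y | #|X| < u * #|[set x | f x p.1 != f x p.2]|)
         #|[set x | f x p.1 == f x p.2]| ^ s)%N.
      under [RHS]eq_bigr => p _ do rewrite -sample_agree -sum1_card.
      under [LHS]eq_bigr => x _ do rewrite -sum1_card.
      rewrite (exchange_big_dep (fun p : Y * Y => (#|X| < u * #|[set x | f x p.1 != f x p.2]|)%N)) /=; last first.
        by move=> x p _; rewrite inE => /andP[].
      apply: eq_bigr => p hp; apply: eq_bigl => x.
      by rewrite !inE hp.
    rewrite big_distrl /=.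
    apply: (@leq_trans (\sum_(p : Y * Y) #|X| ^ s)%N); last first.
      by rewrite sum_nat_const card_prod expnS expn1.
    rewrite big_mkcond /=; apply: leq_sum => p _; case: ifP => // hp.
    (* A far pair agrees on at most (1 - 1/u)|X| vertices, so all un sampled vertices miss its
       difference with probability at most (1 - 1/u)^(un) <= 2^-n. *)
    set A := #|_|.
    have Au : (A * u <= v * #|X|)%N.
      have := cardsC [set x | f x p.1 == f x p.2].
      have -> : ~: [set x | f x p.1 == f x p.2] = [set x | f x p.1 != f x p.2].
        by apply/setP => x; rewrite !inE.
      rewrite -/A; move: hp; set B := #|_|; nia.
    have v_s : (0 < v ^ s)%N by rewrite expn_gt0 v0.
    rewrite -(leq_pmul2r v_s).
    have Aus : ((A * u) ^ s <= (v * #|X|) ^ s)%N.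
      by case: (s) => // s'; rewrite leq_exp2r.
    move: Aus; rewrite !expnMn => Aus.
    apply: (@leq_trans (A ^ s * u ^ s)%N); last by rewrite [leqRHS]mulnC.
    by rewrite -mulnA leq_mul2l /s uv expn_pred_double orbT.
  have := leq_trans h1 h2; rewrite mulnA [leqRHS]mulnC leq_pmul2r ?expn_gt0 ?Y0 //.
  by rewrite mulnC.
have b2 : (2 * #|bad2| < #|X| ^ s)%N.
  have h1 : (#|bad2| * #|Y| ^ 2 ^ k <= \sum_(x : {ffun 'I_s -> X})
      \sum_(j : {ffun 'I_k -> 'I_s} | injectiveb j) w ^ 2 ^ k * #|shatter_ext f (res x j)|)%N.
    rewrite -sum_nat_const [leqRHS](bigID (mem bad2)) /=.
    apply: leq_trans (leq_addr _ _); apply: leq_sum => x; rewrite inE => /existsP[j /andP[ji hj]].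
    by rewrite (bigD1 j) //=; apply: leq_trans (leq_addr _ _).
  have h2 : (N * \sum_(x : {ffun 'I_s -> X})
      \sum_(j : {ffun 'I_k -> 'I_s} | injectiveb j) w ^ 2 ^ k * #|shatter_ext f (res x j)|
      <= s ^ k * (w ^ 2 ^ k * (#|X| ^ s * #|Y| ^ 2 ^ k)))%N.
    rewrite exchange_big big_distrr /=.
    apply: (@leq_trans (\sum_(j : {ffun 'I_k -> 'I_s}) w ^ 2 ^ k * (#|X| ^ s * #|Y| ^ 2 ^ k))%N); last first.
      by rewrite sum_nat_const card_ffun !card_ord.
    rewrite big_mkcond /=; apply: leq_sum => j _; case: ifP => // /injectiveP ji.
    rewrite -big_distrr /= mulnCA leq_mul2l; apply/orP; right.
    have := sum_restrict (fun a => #|shatter_ext f a|) ji => /(leq_mul (leqnn N)) /leq_trans.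
    apply; have ks : (k <= s)%N by rewrite -(card_ord k) -(card_ord s) (leq_card j).
    rewrite mulnCA; apply: (leq_trans (leq_mul (leqnn _) hnip)).
    by rewrite mulnA -expnD subnK.
  have YS : (0 < #|Y| ^ 2 ^ k)%N by rewrite expn_gt0 Y0.
  have := leq_trans (leq_mul (leqnn N) h1) h2.
  rewrite !mulnA leq_pmul2r // => h3.
  have N0 : (0 < N)%N by apply: leq_trans hN.
  rewrite -(ltn_pmul2l N0); apply: (@leq_ltn_trans (2 * s ^ k * w ^ 2 ^ k * #|X| ^ s)%N).
    by rewrite [leqLHS]mulnCA -!mulnA leq_mul2l /= !mulnA.
  by rewrite ltn_pmul2r.
have [x xb] : exists x, x \notin bad1 :|: bad2.
  apply/existsP; apply: contraLR (leq_card_setU bad1 bad2).1; rewrite negb_exists => /forallP h.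
  rewrite -ltnNge; have -> : #|bad1 :|: bad2| = (#|X| ^ s)%N.
    rewrite -[in RHS](card_ord s) -card_ffun; apply: eq_card => x.
    by move: (h x); rewrite negbK => ->.
  lia.
move: xb; rewrite in_setU negb_or => /andP[x1 x2]; exists x; split; last first.
  by move: x1; rewrite inE -leqNgt.
move=> S sh; rewrite leqNgt; apply/negP => kS.
move: x2; rewrite inE => /existsP; apply.
exists [ffun i : 'I_k => enum_val (widen_ord (ltnW kS) i)].
have ji : injective [ffun i : 'I_k => enum_val (widen_ord (ltnW kS) i)].
  by move=> i i'; rewrite !ffunE => /enum_val_inj/(congr1 val) /= /val_inj.
apply/andP; split; first exact/injectiveP.
by apply: (popular_shatter_ext ji _ sh) => i; rewrite ffunE enum_valP.
Qed.

(** * Boxes and the cut norm *)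

Local Open Scope ring_scope.

(** The cut norm, tested on functions bounded by 1 instead of on subsets, so that bounded factors
    depending on one variable only can be absorbed into the tests. *)
Definition cut_small (R : realFieldType) (X Y : finType) (G : X -> Y -> R) (t : R) : Prop :=
  forall (a : X -> R) (b : Y -> R),
    (forall x, `|a x| <= 1) -> (forall y, `|b y| <= 1) ->
    `|\sum_x \sum_y G x y * (a x * b y)| <= t * (#|X|%:R * #|Y|%:R).

Lemma norm_mul_le1 (R : realFieldType) (a b : R) :
  `|a| <= 1 -> `|b| <= 1 -> `|a * b| <= 1.
Proof. by move=> ha hb; rewrite normrM mulr_ile1. Qed.

Lemma norm_bool_le1 (R : realFieldType) (b : bool) : `|b%:R : R| <= 1.
Proof. by case: b; rewrite ?normr1 ?normr0. Qed.

(** The approximant is a sum over the cells in [P] of products of a function of x and the indicator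
    of a cell. Each product is absorbed into the test functions and costs one cut norm of [G]; the
    rest is bounded by the L1 distance to the approximant. *)
Lemma cut_small_cells (R : realFieldType) (X Y I : finType) (G : X -> Y -> R) (t : R)
    (f : X -> Y -> R) (c : Y -> I) (P : {set I}) (A : I -> X -> R)
    (a : X -> R) (b : Y -> R) :
  (forall x y, `|G x y| <= 1) -> cut_small G t -> (forall i x, `|A i x| <= 1) ->
  (forall x, `|a x| <= 1) -> (forall y, `|b y| <= 1) ->
  `|\sum_x \sum_y G x y * f x y * (a x * b y)| <=
  #|P|%:R * (t * (#|X|%:R * #|Y|%:R)) +
  \sum_x \sum_y `|f x y - (c y \in P)%:R * A (c y) x|.
Proof.
move=> G1 Gt A1 a1 b1.
pose H x y := (c y \in P)%:R * A (c y) x.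
have -> : \sum_x \sum_y G x y * f x y * (a x * b y) =
    \sum_x \sum_y G x y * H x y * (a x * b y) +
    \sum_x \sum_y G x y * (f x y - H x y) * (a x * b y).
  rewrite -big_split; apply: eq_bigr => x _; rewrite -big_split; apply: eq_bigr => y _ /=.
  by ring.
apply: le_trans (ler_normD _ _) _; apply: lerD; last first.
  apply: le_trans (ler_norm_sum _ _ _) _; apply: ler_sum => x _.
  apply: le_trans (ler_norm_sum _ _ _) _; apply: ler_sum => y _.
  rewrite -mulrA mulrCA normrM ler_piMr //.
  by apply: norm_mul_le1 => //; apply: norm_mul_le1.
have -> : \sum_x \sum_y G x y * H x y * (a x * b y) =
    \sum_(i in P) \sum_x \sum_y G x y * ((A i x * a x) * ((c y == i)%:R * b y)).
  rewrite [RHS]exchange_big; apply: eq_bigr => x _; rewrite [RHS]exchange_big; apply: eq_bigr => y _ /=.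
  rewrite /H; case: (boolP (c y \in P)) => cP; last first.
    rewrite mul0r mulr0 mul0r big1 // => i iP; case: eqP cP => [->|_ _]; first by rewrite iP.
    by rewrite mul0r !mulr0.
  rewrite (bigD1 (c y)) //= eqxx big1 ?addr0; first by rewrite !mul1r; ring.
  by move=> i /andP[_ ic]; rewrite eq_sym (negPf ic) mul0r !mulr0.
apply: le_trans (ler_norm_sum _ _ _) _.
rewrite mulr_natl -sumr_const; apply: ler_sum => i _; apply: Gt => [x|y].
  exact: norm_mul_le1.
by apply: norm_mul_le1 => //; exact: norm_bool_le1.
Qed.

Lemma sum_natr_card (R : realFieldType) (T : finType) (P : pred T) :
  \sum_(x : T) (P x)%:R = #|[set x | P x]|%:R :> R.
Proof.
rewrite -natr_sum -sum1_card [in RHS]big_mkcond; congr (_ %:R); apply: eq_bigr => x _.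
by rewrite inE; case: (P x).
Qed.

(** The distance to an average is at most the average distance. This turns the approximation error
    into Hamming distances between columns, which sampling controls. *)
Lemma dist_cell_average (R : realFieldType) (X Y : finType) (f : X -> Y -> bool) (S : {set Y}) :
  \sum_x \sum_(y in S) `|(f x y)%:R - (\sum_(y' in S) (f x y')%:R) / #|S|%:R| <=
  (\sum_(y in S) \sum_(y' in S) #|[set x | f x y != f x y']|%:R) / #|S|%:R :> R.
Proof.
have [->|/set0Pn[y0 y0S]] := eqVneq S set0.
  by rewrite big_set0 mul0r big1 // => x _; rewrite big_set0.
have S0 : 0 < #|S|%:R :> R by rewrite ltr0n; apply/card_gt0P; exists y0.
rewrite ler_pdivlMr // exchange_big /= mulr_suml; apply: ler_sum => y _.
rewrite mulr_suml.
apply: (@le_trans _ _ (\sum_x \sum_(y' in S) (f x y != f x y')%:R)); last first.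
  by rewrite exchange_big /=; apply: ler_sum => y' _; rewrite sum_natr_card.
apply: ler_sum => x _; rewrite -{2}(gtr0_norm S0) -normrM mulrBl divfK ?gt_eqF //.
rewrite mulr_natr -sumr_const -sumrB.
apply: le_trans (ler_norm_sum _ _ _) _; apply: ler_sum => y' _.
by case: (f x y); case: (f x y'); rewrite /= ?subrr ?subr0 ?sub0r ?normrN ?normr0 ?normr1.
Qed.

(** A sample of size u n with n = c u leaves at most (un + 1)^k popular traces, still polynomial in
    u, while the fraction 2^-n of unseparated far pairs beats any such polynomial. *)
Lemma box_arith (k : nat) :
  exists c : nat, forall u : nat, (0 < u)%N -> (2 * u ^ 2 * (u * (c * u)).+1 ^ k <= 2 ^ (c * u))%N.
Proof.
have pow4 n : (n + 2 * n ^ 2 <= 4 ^ n)%N.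
  elim: n => // n IH; rewrite [(4 ^ _)%N]expnS; case: n IH => // n; rewrite !expnS; nia.
have lin n : (n <= 2 ^ n)%N by rewrite ltnW // ltn_expl.
(* The constant c has to contain k v, where 2^v bounds c + 1. Since c is quadratic in k and 2^v =
   4^(4+3k), the circular requirement can be met. *)
pose v := (2 * (4 + 2 * k + k))%N; exists (3 + 2 * k + k * v)%N => u u0.
set c := (3 + 2 * k + k * v)%N.
have cv : (c.+1 <= 2 ^ v)%N.
  rewrite /v expnM; apply: leq_trans (pow4 _).
  by rewrite /c /v !expnS; nia.
have h1 : ((u * (c * u)).+1 <= 2 ^ v * (2 ^ u) ^ 2)%N.
  apply: (@leq_trans (c.+1 * u ^ 2)%N); first by rewrite !expnS; nia.
  by apply: leq_mul => //; rewrite leq_exp2r.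
have h2 : (2 * u ^ 2 <= 2 * (2 ^ u) ^ 2)%N by rewrite leq_mul2l leq_exp2r ?lin.
have h3 : ((u * (c * u)).+1 ^ k <= (2 ^ v * (2 ^ u) ^ 2) ^ k)%N.
  by case: (k) => // k'; rewrite leq_exp2r.
apply: leq_trans (leq_mul h2 h3) _.
rewrite -{1}(expn1 2) expnMn -!expnM -!expnD leq_exp2l // /c; nia.
Qed.

(* f is approximated by the union over heavy trace classes T of {average of f over T} x T;
   the sampling and Sauer-Shelah lemmas make the number of classes polynomial in u. *)
Lemma cut_small_nip (R : realFieldType) (k : nat) :
  exists A : nat, forall u : nat, (1 < u)%N -> exists N : nat,
    forall (X Y : finType) (f : X -> Y -> bool), nip k N f ->
    forall (G : X -> Y -> R) (t : R), 0 <= t -> (forall x y, `|G x y| <= 1) -> cut_small G t ->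
      cut_small (fun x y => G x y * (f x y)%:R) (A%:R * u%:R ^+ (2 * k) * t + 4 / u%:R).
Proof.
have [c hc] := box_arith k; exists (c.+1 ^ k)%N => u u1.
have u0 : (0 < u)%N by apply: ltnW.
pose n := (c * u)%N; pose m := ((u * n).+1 ^ k)%N.
(* There are 2^(un) possible traces, so with this [w] the unpopular classes cover at most |Y| / u
   vertices. The exponential size of [w] enters only [N]. *)
pose w := (u * 2 ^ (u * n))%N.
exists (2 * (u * n) ^ k * w ^ 2 ^ k).+1 => X Y f fnip G t t0 G1 Gt a b a1 b1.
have [X0|X0] := posnP #|X|.
  by rewrite big1 ?X0 ?mul0r ?mulr0 ?normr0 // => x; have := fintype0 x; move/(_ X0).
have [Y0|Y0] := posnP #|Y|.
  by rewrite big1 ?Y0 ?mulr0 ?normr0 // => x _; rewrite big1 // => y; have := fintype0 y; move/(_ Y0).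
have uv : u = u.-1.+1 by rewrite prednK.
have v0 : (0 < u.-1)%N by rewrite -ltnS -uv.
have [x [VC far]] := sampling uv v0 (leqnn _) X0 Y0 fnip.
have pop : (#|popular w f x| <= m)%N.
  by apply: leq_trans (sauer_shelah VC) _; rewrite card_ord.
(* Of the at most m popular classes, those smaller than |Y| / (um) are dropped as well, at a further
   cost of |Y| / u. Those kept are large enough to divide by when averaging. *)
pose P := [set T in popular w f x | (#|Y| <= u * m * #|trace_class f x T|)%N].
pose S T := trace_class f x T.
pose Av T x := (\sum_(y' in S T) (f x y')%:R) / #|S T|%:R : R.
have Av1 T z : `|Av T z| <= 1.
  rewrite /Av; have [->|ST0] := eqVneq (S T) set0; first by rewrite big_set0 mul0r normr0.
  have ST : 0 < #|S T|%:R :> R by rewrite ltr0n card_gt0.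
  rewrite normrM normfV (gtr0_norm ST) ler_pdivrMr // mul1r.
  apply: le_trans (ler_norm_sum _ _ _) _; rewrite -sumr_const; apply: ler_sum => y _.
  exact: norm_bool_le1.
have := cut_small_cells (fun x y => (f x y)%:R) (trace f x) P G1 Gt Av1 a1 b1.
move/le_trans; apply.
have XR : 0 < #|X|%:R :> R by rewrite ltr0n.
have YR : 0 < #|Y|%:R :> R by rewrite ltr0n.
have uR : 0 < u%:R :> R by rewrite ltr0n.
rewrite mulrDl; apply: lerD.
  rewrite mulrA ler_wpM2r ?mulr_ge0 // ler_wpM2r // -!natrX -natrM ler_nat.
  apply: (@leq_trans m); first by apply: leq_trans pop; apply: subset_leq_card; apply/subsetP => T; rewrite inE => /andP[].
  rewrite /m expnM -expnMn; have : ((u * n).+1 <= c.+1 * u ^ 2)%N by rewrite /n !expnS; nia.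
  by case: (k) => // k'; rewrite leq_exp2r.
have light : (u * #|[set y | trace f x y \notin P]| <= 2 * #|Y|)%N.
  pose L1 := [set y | trace f x y \notin popular w f x].
  pose L2 := [set y | (trace f x y \in popular w f x) && (trace f x y \notin P)].
  have l12 : (#|[set y | trace f x y \notin P]| <= #|L1| + #|L2|)%N.
    apply: leq_trans (leq_card_setU L1 L2).1; apply: subset_leq_card; apply/subsetP => y.
    by rewrite !inE; case: (_ <= w * _)%N.
  have cardE (Q : pred {set 'I_(u * n)}) : #|[set y | Q (trace f x y)]| = (\sum_(T | Q T) #|S T|)%N.
    rewrite -sum1_card (partition_big (trace f x) Q) => [|y]; last by rewrite inE.
    apply: eq_bigr => T QT; rewrite -sum1_card; apply: eq_bigl => y; rewrite !inE.
    by case: eqP => [->|]; rewrite ?andbT ?andbF.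
  have l1 : (u * #|L1| <= #|Y|)%N.
    rewrite (cardE (fun T => T \notin popular w f x)).
    have p0 : (0 < 2 ^ (u * n))%N by rewrite expn_gt0.
    rewrite -(leq_pmul2l p0) mulnA [(2 ^ _ * u)%N]mulnC -/w big_distrr /=.
    apply: (@leq_trans (\sum_(T : {set 'I_(u * n)}) #|Y|)%N).
      rewrite [leqRHS](bigID (fun T => T \notin popular w f x)) /=; apply: leq_trans (leq_addr _ _).
      by apply: leq_sum => T; rewrite inE -ltnNge => /ltnW.
    by rewrite sum_nat_const (_ : #|_| = 2 ^ (u * n))%N //; exact: card_sets_ord.
  have l2 : (u * #|L2| <= #|Y|)%N.
    rewrite (cardE (fun T => (T \in popular w f x) && (T \notin P))).
    have p0 : (0 < m)%N by rewrite expn_gt0.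
    rewrite -(leq_pmul2l p0) mulnA [(m * u)%N]mulnC big_distrr /=.
    apply: (@leq_trans (\sum_(T in popular w f x) #|Y|)%N); last first.
      by rewrite sum_nat_const leq_mul2r pop orbT.
    rewrite big_mkcondr; apply: leq_sum => T Tp; case: ifP => //.
    by rewrite /P inE Tp /= -ltnNge => /ltnW.
  by have := leq_mul (leqnn u) l12; lia.
rewrite (_ : \sum_i _ = \sum_(y | trace f x y \notin P) \sum_x `|(f x y)%:R| +
   \sum_(T in P) \sum_x \sum_(y in S T) `|(f x y)%:R - Av T x|); last first.
  rewrite exchange_big (bigID (fun y => trace f x y \notin P)) /=; congr (_ + _).
    by apply: eq_bigr => y yP; apply: eq_bigr => z _; rewrite (negPf yP) mul0r subr0.
  under eq_bigl => y do rewrite negbK.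
  rewrite (partition_big (trace f x) (mem P)) //=; apply: eq_bigr => T TP.
  rewrite [RHS]exchange_big /=; apply: eq_big => [y|y /andP[yP /eqP <-]].
    by rewrite [in RHS]inE; case: (trace f x y =P T) => [->|]; rewrite ?andbF ?andbT.
  by apply: eq_bigr => z _; rewrite yP mul1r.
pose D y y' := #|[set z | f z y != f z y']|.
pose far2 y y' : bool := (#|X| < u * D y y')%N.
have farP : (\sum_(T in P) \sum_(y in S T) \sum_(y' in S T) far2 y y' <= #|far_pairs u f x|)%N.
  rewrite -sum1_card.
  rewrite (partition_big (fun p : Y * Y => trace f x p.1) predT) //= [leqRHS](bigID (mem P)) /=.
  apply: leq_trans (leq_addr _ _); apply: leq_sum => T _.
  rewrite pair_big big_mkcond [leqRHS]big_mkcond /=; apply: leq_sum => -[y y'] _ /=.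
  rewrite !inE /= -/(D y y') -/(far2 y y'); case: eqP => //= ->; case: eqP => //= ->.
  by rewrite eqxx andbT; case: (far2 y y').
have DR y y' : (D y y')%:R <= #|X|%:R / u%:R + #|X|%:R * (far2 y y')%:R :> R.
  have := ltnP #|X| (u * D y y'); rewrite -/(far2 y y') => -[] h.
    by rewrite mulr1 -[leLHS]add0r; apply: lerD; rewrite ?divr_ge0 // ler_nat max_card.
  by rewrite mulr0 addr0 ler_pdivlMr // -natrM ler_nat mulnC.
(* The error 4/u is spent as 2/u on the dropped classes, 1/u on close pairs inside a kept class and
   1/u on far pairs that the sample does not separate. *)
have -> : 4 / u%:R * (#|X|%:R * #|Y|%:R) = 2 / u%:R * (#|X|%:R * #|Y|%:R) +
   (#|X|%:R / u%:R * #|Y|%:R + #|X|%:R * #|Y|%:R / u%:R) :> R by field; rewrite gt_eqF.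
apply: lerD.
  apply: (@le_trans _ _ (\sum_(y | trace f x y \notin P) #|X|%:R)).
    apply: ler_sum => y _; rewrite -sumr_const; apply: ler_sum => z _; exact: norm_bool_le1.
  rewrite sumr_const -[X in X <= _]mulr_natr [X in _ <= X]mulrCA ler_wpM2l // mulrAC ler_pdivlMr //.
  rewrite -!natrM ler_nat mulnC; move: light; rewrite cardsE; exact.
apply: (@le_trans _ _ (\sum_(T in P) (#|S T|%:R * (#|X|%:R / u%:R) +
    #|X|%:R * ((u * m)%:R / #|Y|%:R * (\sum_(y in S T) \sum_(y' in S T) far2 y y')%:R)))).
  apply: ler_sum => T TP; apply: le_trans (dist_cell_average _ _ _) _.
  have ST : 0 < #|S T|%:R :> R.
    move: TP; rewrite !inE ltr0n => /andP[_]; rewrite -/(S T); case: #|S T| => //.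
    by rewrite muln0 leqNgt Y0.
  rewrite ler_pdivrMr //.
  apply: (@le_trans _ _ (\sum_(y in S T) \sum_(y' in S T) (#|X|%:R / u%:R + #|X|%:R * (far2 y y')%:R))).
    by apply: ler_sum => y _; apply: ler_sum => y' _; exact: DR.
  under [X in X <= _]eq_bigr => y _ do rewrite big_split /= sumr_const.
  have mulr2n (e : R) (j : nat) : e *+ j *+ j = j%:R * e * j%:R.
    by rewrite -[LHS]mulr_natr -[e *+ j]mulr_natl.
  rewrite big_split /= sumr_const mulr2n [X in _ <= X]mulrDl lerD2l.
  under [X in X <= _]eq_bigr => y _ do rewrite -mulr_sumr -natr_sum.
  rewrite -mulr_sumr -natr_sum -[X in _ <= X]mulrA ler_wpM2l // [X in _ <= X]mulrAC ler_peMl //.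
  rewrite mulrAC ler_pdivlMr // mul1r -natrM ler_nat.
  by move: TP; rewrite inE => /andP[].
rewrite big_split /= -mulr_suml -!mulr_sumr -!natr_sum; apply: lerD.
  rewrite mulrC ler_wpM2l ?divr_ge0 // ler_nat.
  rewrite -[leqRHS]sum1_card (partition_big (trace f x) predT) //= [leqRHS](bigID (mem P)) /=.
  apply: leq_trans (leq_addr _ _); apply: leq_sum => T _; rewrite -sum1_card leq_eqVlt.
  by apply/orP; left; apply/eqP; apply: eq_bigl => y; rewrite inE.
rewrite -[X in _ <= X]mulrA ler_wpM2l //.
(* The factor um / |Y| caused by dividing by the class size is compensated by 2^n >= 2 u^2 m, which
   is [box_arith]. *)
apply: (@le_trans _ _ ((u * m)%:R / #|Y|%:R * (2 * #|Y|%:R ^+ 2 / 2 ^+ n))).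
  rewrite ler_wpM2l ?divr_ge0 // ler_pdivlMr ?exprn_gt0 // -!natrX -!natrM ler_nat.
  by apply: leq_trans far; rewrite leq_mul2r farP orbT.
have -> : (u * m)%:R / #|Y|%:R * (2 * #|Y|%:R ^+ 2 / 2 ^+ n) = #|Y|%:R * ((u * m)%:R * 2 / 2 ^+ n) :> R.
  by field; rewrite expf_neq0 // gt_eqF.
rewrite ler_wpM2l // ler_pdivrMr ?exprn_gt0 // ler_pdivlMl // -!natrX -!natrM ler_nat.
have := hc _ u0; rewrite -/n -/m; nia.
Qed.

(** * Octahedral sums *)

(** The sum over 4-cycles, written as a sum of squared codegrees so that it is visibly nonnegative;
    [C4E] recovers the form symmetric in both sides. *)
Definition C4 (R : realFieldType) (X Y : finType) (F : X -> Y -> R) : R :=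
  \sum_(y : Y * Y) (\sum_x F x y.1 * F x y.2) ^+ 2.

(** The sum over copies of K_{2,2,2}, arranged as a sum over pairs of slices so that estimates for
    bigraphs apply to each pair. *)
Definition oct (R : realFieldType) (X Y Z : finType) (F : X -> Y -> Z -> R) : R :=
  \sum_(z : Z * Z) C4 (fun x y => F x y z.1 * F x y z.2).

Lemma sqr_sum_le (R : realFieldType) (I : finType) (u : I -> R) :
  (\sum_i u i) ^+ 2 <= #|I|%:R * \sum_i u i ^+ 2.
Proof.
have : 0 <= \sum_(i : I) \sum_(j : I) (u i - u j) ^+ 2.
  by apply: sumr_ge0 => i _; apply: sumr_ge0 => j _; exact: sqr_ge0.
have -> : \sum_(i : I) \sum_(j : I) (u i - u j) ^+ 2 =
    2 * (#|I|%:R * \sum_i u i ^+ 2) - 2 * (\sum_i u i) ^+ 2.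
  have -> : \sum_(i : I) \sum_(j : I) (u i - u j) ^+ 2 =
     \sum_(i : I) \sum_(j : I) u i ^+ 2 + \sum_(i : I) \sum_(j : I) u j ^+ 2 - 2 * \sum_(i : I) \sum_(j : I) u i * u j.
    rewrite mulr_sumr -big_split -sumrB; apply: eq_bigr => i _ /=.
    rewrite mulr_sumr -big_split -sumrB; apply: eq_bigr => j _ /=; ring.
  rewrite expr2 big_distrlr /= sumr_const.
  under eq_bigr => i _ do rewrite sumr_const.
  rewrite sumrMnl -!(mulr_natl (\sum_i u i ^+ 2)); ring.
lra.
Qed.

Lemma sqr_sum_wle (R : realFieldType) (I : finType) (a u : I -> R) :
  (forall i, `|a i| <= 1) -> (\sum_i u i * a i) ^+ 2 <= #|I|%:R * \sum_i u i ^+ 2.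
Proof.
move=> a1; apply: le_trans (sqr_sum_le _) _; rewrite ler_wpM2l //.
apply: ler_sum => i _; rewrite exprMn ler_piMr ?sqr_ge0 //.
by rewrite -real_normK ?num_real // expr_le1.
Qed.

Lemma C4_sum (R : realFieldType) (X Y : finType) (F : X -> Y -> R) :
  C4 F = \sum_(y : Y * Y) \sum_(x : X * X)
    F x.1 y.1 * F x.1 y.2 * (F x.2 y.1 * F x.2 y.2).
Proof.
by apply: eq_bigr => y _; rewrite expr2 big_distrlr /= pair_big.
Qed.

Lemma C4E (R : realFieldType) (X Y : finType) (F : X -> Y -> R) :
  C4 F = \sum_x0 \sum_x1 \sum_y0 \sum_y1 F x0 y0 * F x0 y1 * (F x1 y0 * F x1 y1).
Proof.
by rewrite C4_sum exchange_big [RHS]pair_big; apply: eq_bigr => x _; rewrite [RHS]pair_big.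
Qed.

Lemma C4_ge0 (R : realFieldType) (X Y : finType) (F : X -> Y -> R) : 0 <= C4 F.
Proof. by apply: sumr_ge0 => y _; exact: sqr_ge0. Qed.

Lemma C4_le (R : realFieldType) (X Y : finType) (F : X -> Y -> R) :
  (forall x y, `|F x y| <= 1) -> C4 F <= (#|X|%:R * #|Y|%:R) ^+ 2.
Proof.
move=> F1; rewrite C4_sum.
apply: (@le_trans _ _ (\sum_(y : Y * Y) \sum_(x : X * X) 1)).
  apply: ler_sum => y _; apply: ler_sum => x _; apply: le_trans (ler_norm _) _.
  by do !apply: norm_mul_le1.
by rewrite !sumr_const !card_prod -!natrM -natrX -mulrnA ler_nat expnS expn1; nia.
Qed.

Lemma C4_scale (R : realFieldType) (X Y : finType) (p : R) (F : X -> Y -> R) :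
  C4 (fun x y => p * F x y) = p ^+ 4 * C4 F.
Proof.
rewrite !C4_sum mulr_sumr; apply: eq_bigr => y _; rewrite mulr_sumr; apply: eq_bigr => x _.
by ring.
Qed.

Lemma eq_C4 (R : realFieldType) (X Y : finType) (F G : X -> Y -> R) :
  (forall x y, F x y = G x y) -> C4 F = C4 G.
Proof. by move=> h; rewrite !C4_sum; apply: eq_bigr => y _; apply: eq_bigr => x _; rewrite !h. Qed.

(** Two applications of Cauchy-Schwarz, the first removing the test function [a] and the second
    removing [b]. *)
Lemma cut_le_C4 (R : realFieldType) (X Y : finType) (G : X -> Y -> R) (a : X -> R) (b : Y -> R) :
  (forall x, `|a x| <= 1) -> (forall y, `|b y| <= 1) ->
  (\sum_x \sum_y G x y * (a x * b y)) ^+ 4 <= (#|X|%:R * #|Y|%:R) ^+ 2 * C4 G.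
Proof.
move=> a1 b1.
pose T := \sum_x (\sum_y G x y * b y) ^+ 2.
have h1 : (\sum_x \sum_y G x y * (a x * b y)) ^+ 2 <= #|X|%:R * T.
  apply: le_trans (sqr_sum_wle (fun x => \sum_y G x y * b y) a1).
  rewrite le_eqVlt; apply/orP; left; apply/eqP; congr (_ ^+ 2); apply: eq_bigr => x _.
  by rewrite mulr_suml; apply: eq_bigr => y _; ring.
have T0 : 0 <= T by apply: sumr_ge0 => x _; exact: sqr_ge0.
have h2 : T ^+ 2 <= #|Y|%:R ^+ 2 * C4 G.
  have -> : T = \sum_(y : Y * Y) (\sum_x G x y.1 * G x y.2) * (b y.1 * b y.2).
    under [RHS]eq_bigr => y _ do rewrite mulr_suml.
    rewrite exchange_big; apply: eq_bigr => x _ /=.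
    by rewrite expr2 big_distrlr /= pair_big; apply: eq_bigr => y _ /=; ring.
  apply: le_trans (sqr_sum_wle _ _) _; last by rewrite card_prod natrM -expr2.
  by move=> y; apply: norm_mul_le1.
rewrite (_ : 4%N = (2 * 2)%N) // exprM.
apply: (@le_trans _ _ ((#|X|%:R * T) ^+ 2)).
  by rewrite lerXn2r // nnegrE ?sqr_ge0 // mulr_ge0.
by rewrite [X in X <= _]exprMn [X in X * C4 _]exprMn -[X in _ <= X]mulrA; apply: ler_wpM2l => //; apply: exprn_ge0.
Qed.

Lemma cut_small_C4 (R : realFieldType) (X Y : finType) (G : X -> Y -> R) (t : R) :
  0 <= t -> C4 G <= t ^+ 4 * (#|X|%:R * #|Y|%:R) ^+ 2 -> cut_small G t.
Proof.
move=> t0 h a b a1 b1.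
rewrite -(@ler_pXn2r _ 4) ?nnegrE ?mulr_ge0 //.
rewrite -normrX ger0_norm; last by rewrite (exprM _ 2 2) sqr_ge0.
apply: le_trans (cut_le_C4 _ a1 b1) _.
apply: le_trans (ler_wpM2l (sqr_ge0 _) h) _.
rewrite le_eqVlt; apply/orP; left; apply/eqP; ring.
Qed.

Lemma C4_lipschitz (R : realFieldType) (X Y : finType) (F G : X -> Y -> R) (t : R) :
  (forall x y, `|F x y| <= 1) -> (forall x y, `|G x y| <= 1) ->
  cut_small (fun x y => F x y - G x y) t ->
  `|C4 F - C4 G| <= 4 * t * (#|X|%:R * #|Y|%:R) ^+ 2.
Proof.
move=> F1 G1 h; pose D x y := F x y - G x y.
(* Telescoping: the four factors are replaced one at a time. Once the vertices x' and y' off the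
   replaced edge xy are fixed, the other three factors form a function of x times a function of y,
   so the cut norm of F - G applies. *)
pose W (x0 x1 : X) (y0 y1 : Y) : R :=
  D x0 y0 * (F x0 y1 * (F x1 y0 * F x1 y1)) + D x0 y1 * (G x0 y0 * (F x1 y0 * F x1 y1)) +
  (D x1 y0 * (G x0 y0 * (G x0 y1 * F x1 y1)) + D x1 y1 * (G x0 y0 * (G x0 y1 * G x1 y0))).
have -> : C4 F - C4 G = \sum_x0 \sum_x1 \sum_y0 \sum_y1 W x0 x1 y0 y1.
  rewrite !C4E -sumrB; apply: eq_bigr => x0 _; rewrite -sumrB; apply: eq_bigr => x1 _.
  rewrite -sumrB; apply: eq_bigr => y0 _; rewrite -sumrB; apply: eq_bigr => y1 _.
  by rewrite /W /D; ring.
rewrite /W.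
under eq_bigr => x0 _ do under eq_bigr => x1 _ do under eq_bigr => y0 _ do rewrite !big_split /=.
under eq_bigr => x0 _ do under eq_bigr => x1 _ do rewrite !big_split /=.
under eq_bigr => x0 _ do rewrite !big_split /=.
rewrite !big_split /=.
have bnd (S : R) (U : X -> Y -> X -> Y -> R) : (forall x' y', exists a b,
     [/\ forall x, `|a x| <= 1, forall y, `|b y| <= 1 & forall x y, U x y x' y' = D x y * (a x * b y)]) ->
   S = \sum_x' \sum_y' \sum_x \sum_y U x y x' y' -> `|S| <= t * (#|X|%:R * #|Y|%:R) ^+ 2.
  move=> hU ->; apply: le_trans (ler_norm_sum _ _ _) _.
  apply: (@le_trans _ _ (\sum_(x' : X) \sum_(y' : Y) t * (#|X|%:R * #|Y|%:R))).
    apply: ler_sum => x' _; apply: le_trans (ler_norm_sum _ _ _) _; apply: ler_sum => y' _.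
    have [a [b [a1 b1 e]]] := hU x' y'.
    under eq_bigr => x _ do under eq_bigr => y _ do rewrite e.
    exact: h.
  by rewrite !sumr_const -mulrnA -[X in X <= _]mulr_natr natrM expr2; lra.
have -> : 4 * t * (#|X|%:R * #|Y|%:R) ^+ 2 = t * (#|X|%:R * #|Y|%:R) ^+ 2 + t * (#|X|%:R * #|Y|%:R) ^+ 2 +
  (t * (#|X|%:R * #|Y|%:R) ^+ 2 + t * (#|X|%:R * #|Y|%:R) ^+ 2) by ring.
do 2![apply: le_trans (ler_normD _ _) _; apply: lerD].
- apply: (bnd _ (fun x y x' y' => D x y * (F x y' * (F x' y * F x' y')))) => [x' y'|].
    exists (fun x => F x y'), (fun y => F x' y * F x' y').
    by split=> // y; apply: norm_mul_le1.
  rewrite exchange_big; apply: eq_bigr => x' _.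
  by under eq_bigr => x _ do rewrite exchange_big; rewrite exchange_big.
- apply: (bnd _ (fun x y x' y' => D x y * (G x y' * (F x' y' * F x' y)))) => [x' y'|].
    exists (fun x => G x y'), (fun y => F x' y' * F x' y).
    by split=> // y; apply: norm_mul_le1.
  by rewrite exchange_big; apply: eq_bigr => x' _; rewrite exchange_big.
- apply: (bnd _ (fun x y x' y' => D x y * (G x' y * (G x' y' * F x y')))) => [x' y'|].
    exists (fun x => G x' y' * F x y'), (fun y => G x' y).
    by split=> // [x|x y]; [apply: norm_mul_le1|ring].
  apply: eq_bigr => x' _.
  by under eq_bigr => x _ do rewrite exchange_big; rewrite exchange_big.
- apply: (bnd _ (fun x y x' y' => D x y * (G x' y' * (G x' y * G x y')))) => [x' y'|].
    exists (fun x => G x' y' * G x y'), (fun y => G x' y).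
    by split=> // [x|x y]; [apply: norm_mul_le1|ring].
  by apply: eq_bigr => x' _; rewrite exchange_big.
Qed.

Lemma octE (R : realFieldType) (X Y Z : finType) (F : X -> Y -> Z -> R) :
  oct F = \sum_(z : Z * Z) \sum_(y : Y * Y) \sum_(x : X * X)
    F x.1 y.1 z.1 * F x.1 y.1 z.2 * (F x.1 y.2 z.1 * F x.1 y.2 z.2) *
    (F x.2 y.1 z.1 * F x.2 y.1 z.2 * (F x.2 y.2 z.1 * F x.2 y.2 z.2)).
Proof. by apply: eq_bigr => z _; rewrite C4_sum. Qed.

Lemma octE_nested (R : realFieldType) (X Y Z : finType) (F : X -> Y -> Z -> R) :
  oct F = \sum_x0 \sum_x1 \sum_y0 \sum_y1 \sum_z0 \sum_z1
    F x0 y0 z0 * F x0 y0 z1 * (F x0 y1 z0 * F x0 y1 z1) *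
    (F x1 y0 z0 * F x1 y0 z1 * (F x1 y1 z0 * F x1 y1 z1)).
Proof.
rewrite octE; under eq_bigr => z _ do rewrite exchange_big.
rewrite exchange_big [RHS]pair_big; apply: eq_bigr => x _.
rewrite exchange_big [RHS]pair_big; apply: eq_bigr => y _.
by rewrite [RHS]pair_big.
Qed.

Lemma eq_oct (R : realFieldType) (X Y Z : finType) (F G : X -> Y -> Z -> R) :
  (forall x y z, F x y z = G x y z) -> oct F = oct G.
Proof. by move=> h; apply: eq_bigr => z _; apply: eq_C4 => x y; rewrite !h. Qed.

Lemma oct_rot (R : realFieldType) (X Y Z : finType) (F : X -> Y -> Z -> R) :
  oct (fun y z x => F x y z) = oct F.
Proof.
rewrite !octE exchange_big; apply: eq_bigr => z _; rewrite exchange_big.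
by apply: eq_bigr => y _; apply: eq_bigr => x _; ring.
Qed.

(** Cauchy-Schwarz over 4-cycles: the octahedral sum is the sum over 4-cycles of the square of the
    weight that the slices put on it. A small octahedral sum thus makes the average slice
    quasirandom. *)
Lemma sqr_sum_C4_le_oct (R : realFieldType) (X Y Z : finType) (F : X -> Y -> Z -> R) :
  (\sum_z C4 (fun x y => F x y z)) ^+ 2 <= (#|X|%:R * #|Y|%:R) ^+ 2 * oct F.
Proof.
pose W (q : (Y * Y) * (X * X)) z :=
  F q.2.1 q.1.1 z * F q.2.1 q.1.2 z * (F q.2.2 q.1.1 z * F q.2.2 q.1.2 z).
have -> : \sum_z C4 (fun x y => F x y z) = \sum_q \sum_z W q z.
  rewrite [RHS]exchange_big; apply: eq_bigr => z _.
  by rewrite C4_sum pair_big.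
have -> : oct F = \sum_q (\sum_z W q z) ^+ 2.
  rewrite octE; under eq_bigr => z _ do rewrite pair_big.
  rewrite exchange_big; apply: eq_bigr => q _.
  by rewrite expr2 big_distrlr /= pair_big; apply: eq_bigr => z _; rewrite /W; ring.
apply: le_trans (sqr_sum_le _) _.
by rewrite !card_prod !natrM le_eqVlt; apply/orP; left; apply/eqP; ring.
Qed.

(** * Slices of a 3-graph without k (x) U(k) *)

Definition otimes_free (k : nat) (X Y Z : finType) (f : X -> Y -> Z -> bool) : Prop :=
  forall (a : 'I_k -> X) (b : {set 'I_k} -> Y) (c : 'I_k -> Z), injective c ->
    ~ (forall i S m, f (a i) (b S) (c m) = (i \in S)).

Definition bad_slices (k N : nat) (X Y Z : finType) (f : X -> Y -> Z -> bool) : {set Z} :=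
  [set z | ~~ nip k N (fun x y => f x y z)].

(** Double counting: a bad slice contains more than a fraction 1/N of all pairs (a, b), whereas k
    slices sharing one pair would form k (x) U(k). *)
Lemma card_bad_slices (k N : nat) (X Y Z : finType) (f : X -> Y -> Z -> bool) :
  (0 < #|X|)%N -> (0 < #|Y|)%N -> otimes_free k f -> (#|bad_slices k N f| <= N * k)%N.
Proof.
move=> X0 Y0 ff.
have W0 : (0 < #|X| ^ k * #|Y| ^ 2 ^ k)%N by rewrite muln_gt0 !expn_gt0 X0 Y0.
rewrite -(leq_pmul2r W0) -sum_nat_const.
apply: (@leq_trans (\sum_z N * \sum_(a : {ffun 'I_k -> X}) #|shatter_ext (fun x y => f x y z) a|)%N).
  rewrite [leqRHS](bigID (mem (bad_slices k N f))) /=; apply: leq_trans (leq_addr _ _).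
  by apply: leq_sum => z; rewrite inE /nip -ltnNge => /ltnW.
rewrite -big_distrr /= -mulnA leq_mul2l; apply/orP; right.
under eq_bigr => z _ do under eq_bigr => a _ do rewrite -sum1_card big_mkcond.
rewrite exchange_big /=; under eq_bigr => a _ do rewrite exchange_big /=.
apply: (@leq_trans (\sum_(a : {ffun 'I_k -> X}) \sum_(b : {ffun {set 'I_k} -> Y}) k)%N); last first.
  by rewrite !sum_nat_const !card_ffun card_ord card_sets_ord mulnA mulnC.
apply: leq_sum => a _; apply: leq_sum => b _.
rewrite -big_mkcond sum1_card /=; set C := (X in #|X|).
rewrite leqNgt; apply/negP => kC.
apply: (ff a b (fun m => enum_val (widen_ord (ltnW kC) m))).
  by move=> m m' /enum_val_inj/(congr1 val) /= /val_inj.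
move=> i S m; set z := enum_val _.
have : b \in shatter_ext (fun x y => f x y z) a := enum_valP (widen_ord (ltnW kC) m).
by rewrite inE => /forallP/(_ i)/forallP/(_ S)/eqP.
Qed.

Lemma cut_small_nip_sub (R : archiRealFieldType) (k : nat) (delta : R) :
  0 < delta -> exists2 t : R, 0 < t & exists N : nat,
    forall (X Y : finType) (f : X -> Y -> bool) (d : R), nip k N f -> 0 <= d <= 1 ->
    forall (G : X -> Y -> R), (forall x y, `|G x y| <= 1) -> cut_small G t ->
      cut_small (fun x y => G x y * ((f x y)%:R - d)) delta.
Proof.
move=> d0; have [A hA] := cut_small_nip R k.
(* With this [u] the box error 4/u is at most delta/2. The cut norm t of [G] is then fixed by (B +
   1) t = delta/2, the extra 1 paying for the term with [d]. *)
pose u := (Num.trunc (8 / delta)).+2.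
have u0 : 0 < u%:R :> R by rewrite ltr0n.
have u8 : 4 / u%:R <= delta / 2.
  have : 8 / delta < u%:R.
    by apply: lt_trans (truncnS_gt _) _; rewrite ltr_nat.
  rewrite ltr_pdivrMr // ler_pdivrMr // => h; lra.
have [N hN] := hA u isT.
pose B : R := A%:R * u%:R ^+ (2 * k).
have B0 : 0 <= B by rewrite mulr_ge0 // exprn_ge0.
exists (delta / (2 * (B + 1))); first by rewrite divr_gt0 // mulr_gt0 // ltr_wpDl.
exists N => X Y f d fN /andP[dge dle] G G1 Gt a b a1 b1.
set t := delta / _ in Gt.
have B1 : 0 < B + 1 by rewrite ltr_wpDl.
have t0 : 0 <= t by rewrite ltW // divr_gt0 // mulr_gt0.
have h1 := hN X Y f fN G t t0 G1 Gt a b a1 b1.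
have h2 := Gt a b a1 b1.
have -> : \sum_x \sum_y G x y * ((f x y)%:R - d) * (a x * b y) =
   \sum_x \sum_y G x y * (f x y)%:R * (a x * b y) - d * \sum_x \sum_y G x y * (a x * b y).
  rewrite mulr_sumr -sumrB; apply: eq_bigr => x _; rewrite mulr_sumr -sumrB.
  by apply: eq_bigr => y _; ring.
apply: le_trans (ler_normB _ _) _; rewrite normrM (ger0_norm dge).
have XY0 : 0 <= #|X|%:R * #|Y|%:R :> R by rewrite mulr_ge0.
apply: (@le_trans _ _ ((B * t + 4 / u%:R + t) * (#|X|%:R * #|Y|%:R))).
  rewrite mulrDl lerD //; apply: le_trans h2; by rewrite ler_piMl.
rewrite ler_wpM2r //.
have -> : B * t + 4 / u%:R + t = (B + 1) * t + 4 / u%:R by ring.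
have -> : (B + 1) * t = delta / 2 by rewrite /t; field; rewrite gt_eqF.
lra.
Qed.

Lemma norm_sub_le1 (R : archiRealFieldType) (b : bool) (d : R) : 0 <= d <= 1 -> `|b%:R - d| <= 1.
Proof. by case/andP=> d0 d1; rewrite ler_norml; case: b => /=; apply/andP; split; lra. Qed.

(** For a pair of good slices, g - p stays small in the cut norm after multiplication by both, so
    [C4_lipschitz] permits replacing g by p. Pairs with a bad slice are bounded trivially. The
    weights [v] and [w] stand for the two bigraphs that are not being replaced and vanish into the
    test functions. The tolerances are fixed backwards, one for each slice. *)
Lemma oct_replace (R : archiRealFieldType) (k : nat) (delta : R) :
  0 < delta -> exists2 t : R, 0 < t & exists N : nat,
    forall (X Y Z : finType) (f : X -> Y -> Z -> bool) (d p : R) (g : X -> Y -> bool)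
      (v : X -> Z -> R) (w : Y -> Z -> R),
    0 <= d <= 1 -> 0 <= p <= 1 -> (forall x z, `|v x z| <= 1) -> (forall y z, `|w y z| <= 1) ->
    cut_small (fun x y => (g x y)%:R - p) t ->
    `|oct (fun x y z => (g x y)%:R * (((f x y z)%:R - d) * (v x z * w y z)))
      - p ^+ 4 * oct (fun x y z => ((f x y z)%:R - d) * (v x z * w y z))| <=
    (delta * #|Z|%:R ^+ 2 + 2 * #|bad_slices k N f|%:R * #|Z|%:R) * (#|X|%:R * #|Y|%:R) ^+ 2.
Proof.
move=> d0; have d4 : 0 < delta / 4 by lra.
have [t1 t10 [N1 h1]] := cut_small_nip_sub k d4.
have [t2 t20 [N2 h2]] := cut_small_nip_sub k t10.
have nipM (N N' : nat) (X Y : finType) (f : X -> Y -> bool) : nip k (maxn N N') f -> nip k N f /\ nip k N' f.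
  by rewrite /nip => h; split; apply: leq_trans h; rewrite leq_mul2r leq_max leqnn ?orbT.
exists t2 => //; exists (maxn N1 N2) => X Y Z f d p g v w hd hp v1 w1 gt.
set bad := bad_slices _ _ _.
pose F x y z := ((f x y z)%:R - d) * (v x z * w y z).
have F1 x y z : `|F x y z| <= 1.
  by apply: norm_mul_le1; [exact: norm_sub_le1|apply: norm_mul_le1].
have p1 : `|p| <= 1 by case/andP: hp => p0 p1; rewrite ger0_norm.
pose th (z : Z * Z) x y := F x y z.1 * F x y z.2.
have th1 z x y : `|th z x y| <= 1 by apply: norm_mul_le1.
rewrite /oct mulr_sumr -sumrB.
apply: le_trans (ler_norm_sum _ _ _) _.
(* Idempotence lets one factor g serve both slices; this is why p appears to the power 4, one for
   each edge of a 4-cycle, and not 8. *)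
have gg x y : (g x y)%:R * (g x y)%:R = (g x y)%:R :> R by case: (g x y); rewrite ?mulr1 ?mulr0.
pose bz (z : Z * Z) := (z.1 \in bad) || (z.2 \in bad).
set M := (#|X|%:R * #|Y|%:R) ^+ 2.
have M0 : 0 <= M by rewrite sqr_ge0.
apply: (@le_trans _ _ (\sum_(z : Z * Z) (delta + (bz z)%:R) * M)).
  apply: ler_sum => z _.
  rewrite -C4_scale (@eq_C4 _ _ _ _ (fun x y => (g x y)%:R * th z x y)); last first.
    by move=> x y; rewrite -[in RHS]gg /th /F; ring.
  have [zb|zb] := boolP (bz z).
    have A1 := @C4_le R X Y (fun x y => (g x y)%:R * th z x y) (fun x y => norm_mul_le1 (norm_bool_le1 _ _) (th1 z x y)).
    have B1 := @C4_le R X Y (fun x y => p * th z x y) (fun x y => norm_mul_le1 p1 (th1 z x y)).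
    rewrite mulrDl mul1r; have dM : 0 <= delta * M by rewrite mulr_ge0 // ltW.
    have A0 := C4_ge0 (fun x y => (g x y)%:R * th z x y).
    have B0 := C4_ge0 (fun x y => p * th z x y).
    by move: A1 B1 A0 B0; rewrite -/M ler_norml => *; apply/andP; split; lra.
  move: zb; rewrite /bz negb_or !inE !negbK => /andP[/nipM[z1 _] /nipM[_ z2]].
  rewrite addr0 [X in _ <= X * _](_ : delta = 4 * (delta / 4)); last by field.
  apply: C4_lipschitz.
  - by move=> x y; apply: norm_mul_le1 => //; exact: norm_bool_le1.
  - by move=> x y; exact: norm_mul_le1 p1 (th1 z x y).
  move=> a b a1 b1.
  have G1 x y : `|(g x y)%:R - p| <= 1 by exact: norm_sub_le1.
  have c2 := h2 X Y (fun x y => f x y z.2) d z2 hd _ G1 gt.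
  have G2 x y : `|((g x y)%:R - p) * ((f x y z.2)%:R - d)| <= 1.
    exact: norm_mul_le1 (G1 x y) (norm_sub_le1 _ hd).
  have c1 := h1 X Y (fun x y => f x y z.1) d z1 hd _ G2 c2.
  apply: le_trans (c1 (fun x => a x * (v x z.1 * v x z.2))
                      (fun y => b y * (w y z.1 * w y z.2)) _ _).
  - rewrite le_eqVlt; apply/orP; left; apply/eqP; congr `|_|.
    by apply: eq_bigr => x _; apply: eq_bigr => y _; rewrite /th /F; ring.
  - by move=> x; do 2![apply: norm_mul_le1 => //].
  - by move=> y; do 2![apply: norm_mul_le1 => //].
rewrite -mulr_suml ler_wpM2r // big_split /= sumr_const card_prod.
rewrite -[X in X + _]mulr_natr natrM -expr2 lerD2l.
rewrite sum_natr_card -!natrM ler_nat.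
apply: (@leq_trans (#|setX bad [set: Z]| + #|setX [set: Z] bad|)%N); last first.
  by rewrite !cardsX !cardsT [X in (_ + X <= _)%N]mulnC -mulnA mul2n -addnn.
apply: leq_trans (leq_card_setU _ _).1; apply: subset_leq_card; apply/subsetP => -[z z'].
by rewrite inE in_setU !in_setX !in_setT andbT.
Qed.

(* The 8 undoes the eighth power of the octahedral norm; with accuracy u ~ s^-2 the box
   lemma costs a factor u^(2k), and s^(4k+2) u^(2k) ~ s^2. *)
Definition K_exp (k : nat) : nat := (8 * (4 * k + 2))%N.

(** * Small octahedral sums on a full box *)

Lemma sum_const_natr (R : realFieldType) (T : finType) (c : R) :
  \sum_(x : T) c = #|T|%:R * c.
Proof. by rewrite sumr_const mulr_natl. Qed.

(** Repeated Cauchy-Schwarz in z, together with [cut_le_C4] for constant tests. The constants round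
    up successive roots: 4097 <= 65^2 and 65 <= 3^4. *)
Lemma oct_small_average (R : realFieldType) (X Y Z : finType) (F : X -> Y -> Z -> R) (e : R) :
  0 <= e -> oct F <= 4097 * e ^+ 8 * (#|X|%:R * #|Y|%:R * #|Z|%:R) ^+ 2 ->
  \sum_z C4 (fun x y => F x y z) <= 65 * e ^+ 4 * (#|X|%:R * #|Y|%:R) ^+ 2 * #|Z|%:R /\
  `|\sum_z \sum_x \sum_y F x y z| <= 3 * e * (#|X|%:R * #|Y|%:R * #|Z|%:R).
Proof.
move=> e0 hoct; set M := #|X|%:R * #|Y|%:R in hoct *; set n := #|Z|%:R in hoct *.
have M0 : 0 <= M by rewrite mulr_ge0.
have n0 : 0 <= n by rewrite /n.
pose L := \sum_z C4 (fun x y => F x y z).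
have L0 : 0 <= L by apply: sumr_ge0 => z _; exact: C4_ge0.
have hL : L <= 65 * e ^+ 4 * M ^+ 2 * n.
  have r0 : 0 <= 65 * e ^+ 4 * M ^+ 2 * n by rewrite !mulr_ge0 ?exprn_ge0.
  rewrite -(@ler_pXn2r _ 2) ?nnegrE //.
  apply: le_trans (sqr_sum_C4_le_oct F) _; rewrite -/M.
  apply: le_trans (ler_wpM2l (sqr_ge0 _) hoct) _.
  have -> : M ^+ 2 * (4097 * e ^+ 8 * (M * n) ^+ 2) = 4097 * (e ^+ 4 * M ^+ 2 * n) ^+ 2 by ring.
  have -> : (65 * e ^+ 4 * M ^+ 2 * n) ^+ 2 = 4225 * (e ^+ 4 * M ^+ 2 * n) ^+ 2 by ring.
  by apply: ler_wpM2r; [exact: sqr_ge0|lra].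
split=> //.
pose T z := \sum_x \sum_y F x y z.
have T4 z : T z ^+ 4 <= M ^+ 2 * C4 (fun x y => F x y z).
  have := @cut_le_C4 R X Y (fun x y => F x y z) (fun=> 1) (fun=> 1).
  rewrite -/M => /(_ _ _)/(le_trans _) -> //; try by move=> *; rewrite normr1.
  rewrite le_eqVlt; apply/orP; left; apply/eqP; congr (_ ^+ 4).
  by apply: eq_bigr => x _; apply: eq_bigr => y _; rewrite !mulr1.
have r0 : 0 <= 3 * e * (M * n) by rewrite !mulr_ge0.
rewrite -(@ler_pXn2r _ 4) ?nnegrE // -normrX ger0_norm; last by rewrite (exprM _ 2 2) sqr_ge0.
have h1 : (\sum_z T z) ^+ 2 <= n * \sum_z T z ^+ 2 by exact: sqr_sum_le.
have h2 : (\sum_z T z ^+ 2) ^+ 2 <= n * (M ^+ 2 * L).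
  apply: le_trans (sqr_sum_le _) _; rewrite ler_wpM2l // /L mulr_sumr.
  by apply: ler_sum => z _; rewrite -exprM.
have h3 : (\sum_z T z) ^+ 4 <= n ^+ 2 * (n * (M ^+ 2 * L)).
  rewrite (exprM _ 2 2); apply: (@le_trans _ _ ((n * \sum_z T z ^+ 2) ^+ 2)).
    rewrite lerXn2r ?nnegrE ?sqr_ge0 // mulr_ge0 // sumr_ge0 // => z _; exact: sqr_ge0.
  by rewrite exprMn ler_wpM2l // sqr_ge0.
apply: le_trans h3 _.
apply: (@le_trans _ _ (n ^+ 2 * (n * (M ^+ 2 * (65 * e ^+ 4 * M ^+ 2 * n))))).
  by do 2!rewrite ler_wpM2l ?sqr_ge0 //; rewrite ler_wpM2l ?sqr_ge0.
have -> : n ^+ 2 * (n * (M ^+ 2 * (65 * e ^+ 4 * M ^+ 2 * n))) = 65 * (e * (M * n)) ^+ 4 by ring.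
have -> : (3 * e * (M * n)) ^+ 4 = 81 * (e * (M * n)) ^+ 4 by ring.
by rewrite ler_wpM2r ?exprn_ge0 ?ler_nat // !mulr_ge0.
Qed.

(** A good quasirandom slice of f - d is tested against the same slice of f. Since f is 0/1 the
    result is 1 - d times the size of the slice, about d (1 - d)|X||Y|, and the box lemma makes it
    O(s^2). In the application [d] is a density relative to a triad, so it must also be compared
    with the true density [D]. *)
Lemma dense_near01 (R : archiRealFieldType) (k : nat) :
  exists2 s0 : R, 0 < s0 <= 1 & forall s : R, 0 < s < s0 -> exists n0 : nat,
    forall (X Y Z : finType) (f : X -> Y -> Z -> bool) (d : R),
    0 <= d <= 1 -> otimes_free k f -> (0 < #|X|)%N -> (0 < #|Y|)%N -> (n0 < #|Z|)%N ->
    oct (fun x y z => (f x y z)%:R - d) <=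
      4097 * s ^+ K_exp k * (#|X|%:R * #|Y|%:R * #|Z|%:R) ^+ 2 ->
    let D := (\sum_z \sum_x \sum_y (f x y z)%:R) / (#|X|%:R * #|Y|%:R * #|Z|%:R) in
    D < 2 * s \/ 1 - 2 * s < D.
Proof.
have [A hA] := cut_small_nip R k.
(* The box error at u <= 2 / s^2 and cut norm 4 s^(4k+2) is at most C s^2; the summand 8 more than
   covers 4/u <= 4 s^2. *)
pose C : R := A%:R * 2 ^+ (2 * k) * 4 + 8.
have C0 : 0 < C by rewrite /C ltr_wpDl // !mulr_ge0 // exprn_ge0.
(* Here 2 C + 11 = 2 (C + 4) + 3: the bound (C + 4) s^2 on d (1 - d) is doubled when passing to d or
   1 - d, and 3 s^2 bounds the distance from [d] to [D]. Below this threshold the constants are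
   absorbed and less than s remains. *)
exists (1 / (2 * C + 11)) => [|s /andP[s_gt0 s_lt]].
  rewrite divr_gt0 //=; last lra.
  by rewrite ler_pdivrMr ?mul1r; lra.
have s1 : s < 1.
  by apply: lt_le_trans s_lt _; rewrite ler_pdivrMr ?mul1r; lra.
have sC : (2 * C + 11) * s < 1 by move: s_lt; rewrite ltr_pdivlMr 1?mulrC //; lra.
pose u := (Num.trunc (1 / s ^+ 2)).+1.
have s20 : 0 < s ^+ 2 by rewrite exprn_gt0.
have s21 : s ^+ 2 < 1 by rewrite expr_lt1 // ltW.
have ule : u%:R <= 2 / s ^+ 2 :> R.
  have /andP[] := truncn_itv (divr_ge0 ler01 (ltW s20)).
  rewrite /u -natr1 => h _; apply: (le_trans (lerD h (lexx 1))).
  by rewrite -lerBrDl -mulrBl ler_pdivlMr // mul1r; lra.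
have uge : 1 / s ^+ 2 < u%:R :> R by rewrite truncnS_gt.
have u1 : (1 < u)%N.
  rewrite -(ltr_nat R); apply: lt_trans uge; rewrite ltr_pdivlMr // mul1r //.
have u0 : 0 < u%:R :> R by rewrite ltr0n ltnW.
have [N hN] := hA u u1.
exists (2 * (N * k))%N => X Y Z f d hd ff X0 Y0 Z0 hoct D.
set b := (4 * k + 2)%N.
pose e := s ^+ b.
have e0 : 0 < e by rewrite exprn_gt0.
move: hoct; rewrite /K_exp -/b mulnC exprM -/e => /(oct_small_average (ltW e0)).
set F : X -> Y -> Z -> R := fun x y z => (f x y z)%:R - d.
set M := #|X|%:R * #|Y|%:R; set n : R := #|Z|%:R => -[hL hS].
have M0 : 0 < M by rewrite mulr_gt0 ?ltr0n.
have n0 : 0 < n by rewrite ltr0n; apply: leq_trans Z0.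
have badz : (2 * #|bad_slices k N f| < #|Z|)%N.
  by apply: leq_ltn_trans Z0; rewrite leq_mul2l card_bad_slices.
(* Markov: fewer than half of the slices are bad, so some good slice has at most twice the average
   65. Then 130 <= 4^4 gives the cut norm 4 e. *)
have [z zgood C4z] : exists2 z, z \notin bad_slices k N f &
    C4 (fun x y => F x y z) <= 130 * e ^+ 4 * M ^+ 2.
  pose good z := (z \notin bad_slices k N f) && (C4 (fun x y => F x y z) <= 130 * e ^+ 4 * M ^+ 2).
  case: (pickP good) => [z /andP[]|none]; first by exists z.
  have B0 : 0 < e ^+ 4 * M ^+ 2 by rewrite mulr_gt0 // exprn_gt0.
  have : 130 * (e ^+ 4 * M ^+ 2) * #|~: bad_slices k N f|%:R <= \sum_z C4 (fun x y => F x y z).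
    rewrite mulr_natr -sumr_const [leRHS](bigID (mem (~: bad_slices k N f))) /=.
    rewrite -[leLHS]addr0; apply: lerD; last by apply: sumr_ge0 => z _; exact: C4_ge0.
    apply: ler_sum => z; rewrite inE => zb; have := none z.
    by rewrite /good zb /= mulrA => /negbT; rewrite -ltNge => /ltW.
  move=> /le_trans/(_ hL); rewrite -[X in _ <= X * n]mulrA.
  have -> : 65 * (e ^+ 4 * M ^+ 2) * n = 130 * (e ^+ 4 * M ^+ 2) * (n / 2) by field.
  have B1 : 0 < 130 * (e ^+ 4 * M ^+ 2) by rewrite mulr_gt0.
  rewrite (ler_pM2l B1) ler_pdivlMr // /n -natrM ler_nat.
  by move: badz; rewrite -(cardsC (bad_slices k N f)); clear; lia.
have F1 x y : `|F x y z| <= 1 by exact: norm_sub_le1.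
have cutF : cut_small (fun x y => F x y z) (4 * e).
  apply: cut_small_C4; first by rewrite mulr_ge0 // ltW.
  apply: le_trans C4z _; rewrite -/M [(4 * e) ^+ 4]exprMn.
  apply: ler_wpM2r; first exact: sqr_ge0.
  by apply: ler_wpM2r; [rewrite exprn_ge0 // ltW|lra].
have fnip : nip k N (fun x y => f x y z) by move: zgood; rewrite inE negbK.
have t0 : 0 <= 4 * e by rewrite mulr_ge0 // ltW.
have c1 (T : finType) (x : T) : `|1 : R| <= 1 by rewrite normr1.
have h1 := hN X Y (fun x y => f x y z) fnip (fun x y => F x y z) _ t0 F1 cutF (fun=> 1) (fun=> 1)
  (c1 X) (c1 Y).
have h2 := cutF (fun=> 1) (fun=> 1) (c1 X) (c1 Y).
rewrite -/M in h1 h2.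
pose S := \sum_x \sum_y (f x y z)%:R : R.
have E1 : \sum_x \sum_y F x y z * (f x y z)%:R * (1 * 1) = (1 - d) * S.
  rewrite mulr_sumr; apply: eq_bigr => x _; rewrite mulr_sumr; apply: eq_bigr => y _.
  by rewrite /F; case: (f x y z) => /=; ring.
have E2 : \sum_x \sum_y F x y z * (1 * 1) = S - d * M.
  have -> : d * M = \sum_(x : X) \sum_(y : Y) d.
    by rewrite !sum_const_natr /M; ring.
  rewrite -sumrB.
  by apply: eq_bigr => x _; rewrite -sumrB; apply: eq_bigr => y _; rewrite /F !mulr1.
rewrite E1 in h1; rewrite E2 in h2.
have E3 : \sum_z \sum_x \sum_y F x y z = D * (M * n) - d * (M * n).
  rewrite /D divfK ?gt_eqF ?mulr_gt0 ?ltr0n //; last by apply: leq_trans Z0.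
  have -> : d * (M * n) = \sum_(z : Z) \sum_(x : X) \sum_(y : Y) d.
    by rewrite !sum_const_natr /M /n; ring.
  rewrite -sumrB; apply: eq_bigr => z' _; rewrite -sumrB; apply: eq_bigr => x _.
  by rewrite -sumrB.
have box : A%:R * u%:R ^+ (2 * k) * (4 * e) + 4 / u%:R <= C * s ^+ 2.
  have h4 : 4 / u%:R <= 4 * s ^+ 2.
    by move: uge; rewrite ltr_pdivrMr // ler_pdivrMr //; lra.
  have hu : u%:R ^+ (2 * k) * e <= 2 ^+ (2 * k) * s ^+ 2.
    apply: (@le_trans _ _ ((2 / s ^+ 2) ^+ (2 * k) * e)).
      apply: ler_wpM2r; first exact: ltW.
      by apply: lerXn2r => //; rewrite nnegrE // divr_ge0 // ltW.
    rewrite exprMn exprVn -mulrA ler_wpM2l ?exprn_ge0 //.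
    rewrite /e /b exprD -exprM (_ : (2 * (2 * k) = 4 * k)%N); last by rewrite mulnA.
    by rewrite mulKf // expf_neq0 // gt_eqF.
  have -> : A%:R * u%:R ^+ (2 * k) * (4 * e) = A%:R * 4 * (u%:R ^+ (2 * k) * e) by ring.
  have A4 : 0 <= A%:R * 4 :> R by rewrite mulr_ge0.
  have := ler_wpM2l A4 hu; rewrite /C => h5.
  have -> : (A%:R * 2 ^+ (2 * k) * 4 + 8) * s ^+ 2 = A%:R * 4 * (2 ^+ (2 * k) * s ^+ 2) + 8 * s ^+ 2 by ring.
  by apply: lerD => //; lra.
have es : e <= s ^+ 2.
  by rewrite /e /b exprD; apply: ler_piMl; [exact: ltW|apply: exprn_ile1; exact: ltW].
have /andP[d0 d1] := hd.
have dd : d * (1 - d) <= (C + 4) * s ^+ 2.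
  rewrite -(ler_pM2r M0).
  have -> : d * (1 - d) * M = (1 - d) * S - (1 - d) * (S - d * M) by ring.
  have h3 : (1 - d) * S <= C * s ^+ 2 * M.
    apply: le_trans (ler_norm _) _; apply: le_trans h1 _.
    by apply: ler_wpM2r; first exact: ltW.
  have h4 : - ((1 - d) * (S - d * M)) <= 4 * s ^+ 2 * M.
    apply: le_trans (ler_norm _) _; rewrite normrN normrM ger0_norm; last by lra.
    apply: (@le_trans _ _ `|S - d * M|); first by apply: ler_piMl => //; lra.
    apply: le_trans h2 _; apply: ler_wpM2r; first exact: ltW.
    by apply: ler_wpM2l.
  have -> : (C + 4) * s ^+ 2 * M = C * s ^+ 2 * M + 4 * s ^+ 2 * M by ring.
  exact: lerD.
have hDd : `|D - d| <= 3 * s ^+ 2.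
  move: hS; rewrite E3 -mulrBl normrM (gtr0_norm (mulr_gt0 M0 n0)) (ler_pM2r (mulr_gt0 M0 n0)).
  by move=> h; apply: le_trans h _; rewrite ler_wpM2l.
have sfin : (2 * C + 11) * s ^+ 2 < s by rewrite expr2 mulrA gtr_pMl.
move: hDd; rewrite ler_norml => /andP[D1 D2].
have s2' := ltW s20.
have [dh|dh] := lerP d (1 / 2).
  left; have : d * (1 / 2) <= d * (1 - d) by rewrite ler_wpM2l //; lra.
  by move=> h; lra.
right; have : (1 / 2) * (1 - d) <= d * (1 - d) by rewrite ler_wpM2r //; lra.
by move=> h; lra.
Qed.

(** * Removing the three bigraphs *)

Lemma cut_small_tr (R : realFieldType) (X Y : finType) (G : X -> Y -> R) (t : R) :
  cut_small G t -> cut_small (fun y x => G x y) t.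
Proof.
move=> h b a b1 a1; rewrite [#|Y|%:R * _]mulrC exchange_big; apply: le_trans (h a b a1 b1).
rewrite le_eqVlt; apply/orP; left; apply/eqP; congr `|_|.
by apply: eq_bigr => x _; apply: eq_bigr => y _; rewrite [b y * _]mulrC.
Qed.

Lemma oct_rot2 (R : realFieldType) (X Y Z : finType) (F : X -> Y -> Z -> R) :
  oct (fun z x y => F x y z) = oct F.
Proof. by rewrite -(oct_rot F) -[RHS]oct_rot. Qed.

(** The bigraphs are replaced one after another, each time rotating the classes so that slices are
    taken over the class outside the bigraph. This is why all three rotations of f must be free of
    the configuration. *)
Lemma oct_strip (R : archiRealFieldType) (k : nat) (delta : R) :
  0 < delta -> exists2 t : R, 0 < t & exists n0 : nat,
    forall (X Y Z : finType) (f : X -> Y -> Z -> bool) (d p q r : R)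
      (gXY : X -> Y -> bool) (gXZ : X -> Z -> bool) (gYZ : Y -> Z -> bool),
    [/\ 0 <= d <= 1, 0 <= p <= 1, 0 <= q <= 1 & 0 <= r <= 1] ->
    [/\ (n0 < #|X|)%N, (n0 < #|Y|)%N & (n0 < #|Z|)%N] ->
    [/\ otimes_free k f, otimes_free k (fun y z x => f x y z)
      & otimes_free k (fun z x y => f x y z)] ->
    cut_small (fun x y => (gXY x y)%:R - p) t -> cut_small (fun x z => (gXZ x z)%:R - q) t ->
    cut_small (fun y z => (gYZ y z)%:R - r) t ->
    (p * q * r) ^+ 4 * oct (fun x y z => (f x y z)%:R - d) <=
    oct (fun x y z => ((f x y z)%:R - d) * (gXY x y && gXZ x z && gYZ y z)%:R)
    + delta * (#|X|%:R * #|Y|%:R * #|Z|%:R) ^+ 2.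
Proof.
move=> d0; have d6 : 0 < delta / 6 by lra.
have [t t0 [N hN]] := oct_replace k d6.
(* Each replacement may cost delta/3: half for the good pairs of slices, half for the at most N k
   bad slices once the third class exceeds [n0]. *)
pose n0 := Num.trunc ((2 * N * k)%:R / (delta / 6)).
exists t => //; exists n0 => X Y Z f d p q r gXY gXZ gYZ [hd hp hq hr] [nX nY nZ] [fXY fYZ fZX].
move=> cXY cXZ cYZ.
set V : R := #|X|%:R * #|Y|%:R * #|Z|%:R; have V0 : 0 <= V ^+ 2 by exact: sqr_ge0.
have err (A B C : finType) (h : A -> B -> C -> bool) (W : R) : (n0 < #|A|)%N -> (n0 < #|B|)%N ->
    (n0 < #|C|)%N -> otimes_free k h ->
    W <= (delta / 6 * #|C|%:R ^+ 2 + 2 * #|bad_slices k N h|%:R * #|C|%:R) * (#|A|%:R * #|B|%:R) ^+ 2 ->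
    W <= delta / 3 * (#|A|%:R * #|B|%:R * #|C|%:R) ^+ 2.
  move=> nA nB nC hfree /le_trans; apply.
  have -> : delta / 3 * (#|A|%:R * #|B|%:R * #|C|%:R) ^+ 2 =
      delta / 3 * #|C|%:R ^+ 2 * (#|A|%:R * #|B|%:R) ^+ 2 by ring.
  apply: ler_wpM2r; first exact: sqr_ge0.
  have hb : (#|bad_slices k N h| <= N * k)%N.
    exact: card_bad_slices (leq_ltn_trans (leq0n _) nA) (leq_ltn_trans (leq0n _) nB) hfree.
  have : (2 * N * k)%:R / (delta / 6) < #|C|%:R.
    by apply: lt_le_trans (truncnS_gt _) _; rewrite ler_nat.
  rewrite ltr_pdivrMr // => hC.
  have h2 : 2 * #|bad_slices k N h|%:R <= delta / 6 * #|C|%:R.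
    rewrite [leRHS]mulrC; apply: le_trans (ltW hC); rewrite -natrM ler_nat.
    by rewrite -mulnA leq_mul2l.
  apply: le_trans (lerD (lexx _) (ler_wpM2r (ler0n R #|C|) h2)) _.
  by rewrite le_eqVlt; apply/orP; left; apply/eqP; field.
have n1 (T : finType) (b : T -> bool) x : `|(b x)%:R : R| <= 1 by exact: norm_bool_le1.
have n11 : `|1 : R| <= 1 by rewrite normr1.
pose F3 x y z : R := (gXY x y)%:R * (((f x y z)%:R - d) * ((gXZ x z)%:R * (gYZ y z)%:R)).
pose F2 x y z : R := ((f x y z)%:R - d) * ((gXZ x z)%:R * (gYZ y z)%:R).
pose F1 x y z : R := ((f x y z)%:R - d) * (gYZ y z)%:R.
pose F0 x y z : R := (f x y z)%:R - d.
have s3 : `|oct F3 - p ^+ 4 * oct F2| <= delta / 3 * V ^+ 2.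
  apply: (err X Y Z f _ nX nY nZ fXY); apply: (hN X Y Z f d p gXY _ _ hd hp) => // *; exact: norm_bool_le1.
have s2 : `|oct F2 - q ^+ 4 * oct F1| <= delta / 3 * V ^+ 2.
  rewrite -(oct_rot2 F2) -(oct_rot2 F1).
  rewrite (_ : V = #|Z|%:R * #|X|%:R * #|Y|%:R); last by rewrite /V; ring.
  apply: (err Z X Y (fun z x y => f x y z) _ nZ nX nY fZX).
  have := hN Z X Y (fun z x y => f x y z) d q (fun z x => gXZ x z) (fun z y => (gYZ y z)%:R) (fun _ _ => 1) hd hq _ _ (cut_small_tr cXZ).
  move=> /(_ (fun z y => norm_bool_le1 _ _) (fun _ _ => n11)) /(le_trans _); apply.
  rewrite le_eqVlt; apply/orP; left; apply/eqP; congr `|_ - _ * _|; apply: eq_oct => z x y.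
    by rewrite /F2; ring.
  by rewrite /F1; ring.
have s1 : `|oct F1 - r ^+ 4 * oct F0| <= delta / 3 * V ^+ 2.
  rewrite -(oct_rot F1) -(oct_rot F0).
  rewrite (_ : V = #|Y|%:R * #|Z|%:R * #|X|%:R); last by rewrite /V; ring.
  apply: (err Y Z X (fun y z x => f x y z) _ nY nZ nX fYZ).
  have := hN Y Z X (fun y z x => f x y z) d r gYZ (fun _ _ => 1) (fun _ _ => 1) hd hr (fun _ _ => n11) (fun _ _ => n11) cYZ.
  move=> /(le_trans _); apply.
  rewrite le_eqVlt; apply/orP; left; apply/eqP; congr `|_ - _ * _|; apply: eq_oct => y z x.
    by rewrite /F1; ring.
  by rewrite /F0; ring.
rewrite (@eq_oct _ _ _ _ (fun x y z => _ * (_ && _ && _)%:R) F3); last first.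
  by move=> x y z; rewrite /F3; case: (gXY x y); case: (gXZ x z); case: (gYZ y z); rewrite /=; ring.
rewrite -/F0.
have pw (c : R) : 0 <= c <= 1 -> 0 <= c ^+ 4 <= 1.
  by case/andP=> c0 c1; rewrite exprn_ge0 //= expr_le1.
have /andP[p0 p1] := pw _ hp; have /andP[q0 q1] := pw _ hq; have /andP[r0 r1] := pw _ hr.
move: s3 s2 s1; rewrite !ler_norml; set e := delta / 3 * V ^+ 2.
have e0 : 0 <= e by rewrite mulr_ge0 //; lra.
move=> /andP[s3 _] /andP[s2 _] /andP[s1 _].
have -> : delta * V ^+ 2 = e + e + e by rewrite /e; field.
have g2 : q ^+ 4 * (r ^+ 4 * oct F0) <= oct F2 + e + e.
  have : q ^+ 4 * (r ^+ 4 * oct F0) <= q ^+ 4 * (oct F1 + e) by rewrite ler_wpM2l //; lra.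
  have : q ^+ 4 * e <= e by rewrite ler_piMl.
  by rewrite mulrDr; lra.
have -> : (p * q * r) ^+ 4 * oct F0 = p ^+ 4 * (q ^+ 4 * (r ^+ 4 * oct F0)) by ring.
have := ler_wpM2l p0 g2.
have : p ^+ 4 * (e + e) <= e + e by rewrite ler_piMl //; lra.
rewrite !mulrDr; lra.
Qed.

(** * Triads of 3-graphs *)

(** The threshold [eta] depends on [l] because the stripping error must be small against (p q r)^4,
    and the densities are bounded below only by s^K / l. The dense constant 4097 is 4096 plus 1 for
    this error. *)
Lemma triad_near01 (R : archiRealFieldType) (k : nat) :
  exists2 s0 : R, 0 < s0 <= 1 & forall (s : R) (l : nat), 0 < s < s0 -> (0 < l)%N ->
    exists2 eta : R, 0 < eta <= 1 & exists n0 : nat,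
    forall (X Y Z : finType) (f : X -> Y -> Z -> bool) (d p q r : R)
      (gXY : X -> Y -> bool) (gXZ : X -> Z -> bool) (gYZ : Y -> Z -> bool),
    [/\ (n0 < #|X|)%N, (n0 < #|Y|)%N & (n0 < #|Z|)%N] ->
    [/\ otimes_free k f, otimes_free k (fun y z x => f x y z)
      & otimes_free k (fun z x y => f x y z)] ->
    [/\ 0 <= d <= 1, s ^+ K_exp k / l%:R <= p <= 1, s ^+ K_exp k / l%:R <= q <= 1
      & s ^+ K_exp k / l%:R <= r <= 1] ->
    [/\ C4 (fun x y => (gXY x y)%:R - p) <= eta * (#|X|%:R * #|Y|%:R) ^+ 2,
        C4 (fun x z => (gXZ x z)%:R - q) <= eta * (#|X|%:R * #|Z|%:R) ^+ 2
      & C4 (fun y z => (gYZ y z)%:R - r) <= eta * (#|Y|%:R * #|Z|%:R) ^+ 2] ->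
    oct (fun x y z => ((f x y z)%:R - d) * (gXY x y && gXZ x z && gYZ y z)%:R) <=
      4096 * s ^+ K_exp k * (p * q * r) ^+ 4 * (#|X|%:R * #|Y|%:R * #|Z|%:R) ^+ 2 ->
    let D := (\sum_z \sum_x \sum_y (f x y z)%:R) / (#|X|%:R * #|Y|%:R * #|Z|%:R) in
    D < 2 * s \/ 1 - 2 * s < D.
Proof.
have [s0 s0P dense] := dense_near01 R k.
exists s0 => // s l sP l0; have /andP[s_gt0 _] := sP.
set e := s ^+ K_exp k; have e0 : 0 < e by rewrite exprn_gt0.
have lR : 0 < l%:R :> R by rewrite ltr0n.
have el : 0 < e / l%:R by rewrite divr_gt0.
have d0 : 0 < e * ((e / l%:R) * (e / l%:R) * (e / l%:R)) ^+ 4.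
  exact: mulr_gt0 e0 (exprn_gt0 _ (mulr_gt0 (mulr_gt0 el el) el)).
have [t t0 [n1 strip]] := oct_strip k d0.
have [n2 {}dense] := dense s sP.
exists (Num.min 1 (t ^+ 4)).
  by rewrite lt_min ltr01 exprn_gt0 // ge_min lexx.
exists (maxn n1 n2) => X Y Z f d p q r gXY gXZ gYZ [nX nY nZ] free [hd hp hq hr] [cXY cXZ cYZ] ho.
have {}nX := leq_ltn_trans (leq_maxl _ _) nX.
have {}nY := leq_ltn_trans (leq_maxl _ _) nY.
have nZ1 := leq_ltn_trans (leq_maxl _ _) nZ.
have nZ2 := leq_ltn_trans (leq_maxr _ _) nZ.
have [f1 _ _] := free.
apply: (dense X Y Z f d hd f1 (leq_ltn_trans (leq0n _) nX) (leq_ltn_trans (leq0n _) nY) nZ2).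
have cut (A B : finType) (G : A -> B -> R) :
    C4 G <= Num.min 1 (t ^+ 4) * (#|A|%:R * #|B|%:R) ^+ 2 -> cut_small G t.
  move=> h; apply: cut_small_C4; first exact: ltW.
  by apply: le_trans h _; rewrite ler_wpM2r ?sqr_ge0 // ge_min lexx orbT.
have w1 (c : R) : e / l%:R <= c <= 1 -> 0 <= c <= 1.
  by case/andP=> c0 ->; rewrite andbT (le_trans (ltW el)).
have := strip X Y Z f d p q r gXY gXZ gYZ (And4 hd (w1 _ hp) (w1 _ hq) (w1 _ hr)) (And3 nX nY nZ1)
  free (cut _ _ _ cXY) (cut _ _ _ cXZ) (cut _ _ _ cYZ).
set O := oct _ in ho *; set O' := oct _ => hs.
have /andP[p0 _] := hp; have /andP[q0 _] := hq; have /andP[r0 _] := hr.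
have pqr : e / l%:R * (e / l%:R) * (e / l%:R) <= p * q * r.
  have el0 := ltW el; by apply: ler_pM => //; [exact: mulr_ge0|exact: ler_pM].
have pqr4 : (e / l%:R * (e / l%:R) * (e / l%:R)) ^+ 4 <= (p * q * r) ^+ 4.
  have c0 := ltW (mulr_gt0 (mulr_gt0 el el) el).
  by apply: lerXn2r => //; rewrite nnegrE // (le_trans c0).
have pqr0 : 0 < (p * q * r) ^+ 4.
  exact: exprn_gt0 _ (lt_le_trans (mulr_gt0 (mulr_gt0 el el) el) pqr).
rewrite -(ler_pM2l pqr0); apply: le_trans hs _.
set W := (#|X|%:R * #|Y|%:R * #|Z|%:R) ^+ 2 in ho *.
have W0 : 0 <= W by rewrite sqr_ge0.
have h2 := ler_wpM2r W0 (ler_wpM2l (ltW e0) pqr4).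
apply: le_trans (lerD ho h2) _.
rewrite le_eqVlt; apply/orP; left; apply/eqP; rewrite -/e; ring.
Qed.

Lemma oedge3_rot (H : graph3) (x y z : H) :
  ((x, y, z) \in oedge3 H) = ((y, z, x) \in oedge3 H).
Proof. by rewrite !inE /= -setUA setUC. Qed.

Lemma induced3_trip_iso (G H : graph3) (phi : G -> H) :
  injective phi -> (forall e : {set G}, (phi @: e \in edge3 H) = (e \in edge3 G)) ->
  iso3 (induced3 [set phi x | x : G]) G.
Proof.
move=> inj hphi; set A := [set phi x | x : G].
have ph (u : {x | x \in A}) : exists x, phi x == val u.
  by have /imsetP[x _ ->] := valP u; exists x.
pose g u := xchoose (ph u).
have gP u : phi (g u) = val u := eqP (xchooseP (ph u)).
have hA x : phi x \in A by apply: imset_f.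
exists g => [|e].
  exists (fun x => exist _ (phi x) (hA x)) => [u|x]; first by apply/val_inj; rewrite /= gP.
  by apply: inj; rewrite gP.
rewrite -hphi inE -imset_comp.
by rewrite (@eq_in_imset _ _ (phi \o g) val) // => u _; exact: gP.
Qed.

(** In [trip H] the images of a, b and c lie in three different copies of the vertex set, so they
    stay apart even if the classes X, Y, Z overlap in [H], and no edges arise inside them. The copy
    is therefore induced. *)
Lemma Trip_otimes_free (P : graph3 -> Prop) (k : nat) (H : graph3) (X Y Z : finType)
    (u : X -> H) (v : Y -> H) (w : Z -> H) :
  ~ Trip P (otimes k (Ugraph k)) -> P H -> injective w ->
  otimes_free k (fun x y z => (u x, v y, w z) \in oedge3 H).
Proof.
move=> nT PH winj a b c cinj h; apply: nT => Q [Qiso Qind] hQ.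
have QH : Q (trip H) by apply: hQ; exists H.
pose phi (g : otimes k (Ugraph k)) : trip H :=
  match g with
  | inl (inl i) => trip_a (u (a i))
  | inl (inr T) => trip_b (v (b T))
  | inr m => trip_c (w (c m))
  end.
(* The incidence pattern of U(k) separates the values of [a] and those of [b]; on the third class
   injectivity comes from [w] and [c]. *)
have phi_inj : injective phi.
  move=> [[i|S]|m] [[i'|S']|m'] //= [].
  - move=> e; have [m0 _] : exists m : 'I_k, true by exists i.
    have := h i' [set i] m0; have := h i [set i] m0.
    by rewrite e !inE eqxx => -> /esym/eqP ->.
  - move=> e; congr (inl (inr _)); apply/setP => i.
    by have := h i S i; have := h i S' i; rewrite e => ->.
  - by move/winj/cinj ->.
have phiE i S m : phi @: (inr m |: inl @: [set inl i; inr S]) =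
    [set trip_a (u (a i)); trip_b (v (b S)); trip_c (w (c m))].
  have -> : inl @: [set inl i; inr S] = [set inl (inl i); inl (inr S)] :> {set otimes k (Ugraph k)}.
    by rewrite imsetU !imset_set1.
  by rewrite imsetU1 imsetU !imset_set1 setUC.
apply: Qiso (Qind _ [set phi x | x : otimes k (Ugraph k)] QH).
apply: induced3_trip_iso => // e.
apply/imsetP/imset2P.
- case=> -[[p q] r] /= pe phie.
  have mem x : x \in [set trip_a p; trip_b q; trip_c r] -> exists2 y, y \in e & x = phi y.
    by rewrite -phie => /imsetP.
  have [|[[i|S]|m] // ie [pi]] := mem (trip_a p); first by rewrite !inE eqxx.
  have [|[[i'|S]|m] // Se [qS]] := mem (trip_b q); first by rewrite !inE eqxx orbT.
  have [|[[i'|S']|m] // me [rm]] := mem (trip_c r); first by rewrite !inE eqxx orbT.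
  exists [set inl i; inr S] m => //.
  - apply/imsetP; exists (i, S) => //; rewrite inE /=.
    by rewrite -(h i S m) -pi -qS -rm.
  - by rewrite in_setT.
  have : phi @: e = phi @: (inr m |: inl @: [set inl i; inr S]).
    by rewrite phiE phie pi qS rm.
  exact: (imset_inj phi_inj).
case=> xy m /imsetP[[i S]]; rewrite inE /= => iS -> _ ->.
exists (u (a i), v (b S), w (c m)); first by rewrite h.
exact: phiE.
Qed.

(** Indexing a set by ['I_#|A|] turns classes that may overlap into independent types, to which the
    analytic lemmas apply. *)
Lemma dev2_sum_C4 (R : realType) (V : finType) (B : bigraph V) :
  \sum_(u0 in bleft B) \sum_(u1 in bleft B) \sum_(w0 in bright B) \sum_(w1 in bright B)
    \prod_(i : bool) \prod_(j : bool)
      balanced2 R B (if i then u1 else u0) (if j then w1 else w0) =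
  C4 (fun (x : 'I_#|bleft B|) (y : 'I_#|bright B|) =>
        ((enum_val x, enum_val y) \in bedge B)%:R - dens2 R B).
Proof.
have bE u w : balanced2 R B u w = ((u, w) \in bedge B)%:R - dens2 R B.
  by rewrite /balanced2; case: ifP => _; rewrite ?sub0r.
rewrite C4E big_enum_val; apply: eq_bigr => x0 _; rewrite big_enum_val; apply: eq_bigr => x1 _.
rewrite big_enum_val; apply: eq_bigr => y0 _; rewrite big_enum_val; apply: eq_bigr => y1 _.
by rewrite !big_bool /= !bE; ring.
Qed.

Lemma dev23_sum_oct (R : realType) (H : graph3) (G : triad H) :
  \sum_(u0 in tX G) \sum_(u1 in tX G) \sum_(w0 in tY G) \sum_(w1 in tY G)
  \sum_(z0 in tZ G) \sum_(z1 in tZ G)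
    \prod_(i : bool) \prod_(j : bool) \prod_(k : bool)
      balanced3 R G (if i then u1 else u0) (if j then w1 else w0) (if k then z1 else z0) =
  oct (fun (x : 'I_#|tX G|) (y : 'I_#|tY G|) (z : 'I_#|tZ G|) =>
        (((enum_val x, enum_val y, enum_val z) \in oedge3 H)%:R - tdens R G) *
        (((enum_val x, enum_val y) \in tXY G) && ((enum_val x, enum_val z) \in tXZ G)
         && ((enum_val y, enum_val z) \in tYZ G))%:R).
Proof.
have bE x y z : balanced3 R G x y z = (((x, y, z) \in oedge3 H)%:R - tdens R G) *
    (((x, y) \in tXY G) && ((x, z) \in tXZ G) && ((y, z) \in tYZ G))%:R.
  rewrite /balanced3 in_setI [_ \in K3 G]inE /=.
  case: ((x, y, z) \in oedge3 H); case: (_ \in tXY G); case: (_ \in tXZ G); case: (_ \in tYZ G);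
    by rewrite /= ?sub0r ?mulr1 ?mulr0.
rewrite octE_nested big_enum_val; apply: eq_bigr => x0 _; rewrite big_enum_val; apply: eq_bigr => x1 _.
rewrite big_enum_val; apply: eq_bigr => y0 _; rewrite big_enum_val; apply: eq_bigr => y1 _.
rewrite big_enum_val; apply: eq_bigr => z0 _; rewrite big_enum_val; apply: eq_bigr => z1 _.
rewrite !big_bool /= !bE.
(* [big_bool] lists [true] before [false], so the eight factors appear in reverse order. *)
have perm (a b c d e f g h : R) : a * b * (c * d) * (e * f * (g * h)) =
  h * g * (f * e) * (d * c * (b * a)) by ring.
exact: perm.
Qed.

Lemma dens3_sum (R : realType) (H : graph3) (X Y Z : {set H}) :
  dens3 R X Y Z =
  (\sum_(z : 'I_#|Z|) \sum_(x : 'I_#|X|) \sum_(y : 'I_#|Y|)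
     ((enum_val x, enum_val y, enum_val z) \in oedge3 H)%:R) /
  (#|'I_#|X| |%:R * #|'I_#|Y| |%:R * #|'I_#|Z| |%:R).
Proof.
rewrite /dens3 !card_ord; congr (_ / _).
pose F x y z : R := ((x, y, z) \in oedge3 H)%:R.
transitivity (\sum_(z in Z) \sum_(x in X) \sum_(y in Y) F x y z); last first.
  rewrite big_enum_val; apply: eq_bigr => z _; rewrite big_enum_val; apply: eq_bigr => x _.
  by rewrite big_enum_val.
rewrite exchange_big /=; under eq_bigr => x _ do rewrite exchange_big /=.
rewrite pair_big pair_big /= -sum1_card natr_sum big_mkcond [RHS]big_mkcond /=.
apply: eq_bigr => -[[x y] z] _; rewrite in_setI !in_setX /= /F.
by case: (_ \in oedge3 H); case: (x \in X); case: (y \in Y); case: (z \in Z).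
Qed.

Lemma natr_div_bound (R : realType) (m n : nat) : (m <= n)%N -> 0 <= (m%:R / n%:R : R) <= 1.
Proof.
move=> mn; rewrite divr_ge0 //=; case: n mn => [|n] mn; first by rewrite invr0 mulr0.
by rewrite ler_pdivrMr ?ltr0n // mul1r ler_nat.
Qed.

Lemma tdens_bound (R : realType) (H : graph3) (G : triad H) : 0 <= tdens R G <= 1.
Proof. by apply/natr_div_bound/subset_leq_card/subsetIr. Qed.

Lemma dens2_bound (R : realType) (V : finType) (B : bigraph V) : 0 <= dens2 R B <= 1.
Proof.
rewrite /dens2 -natrM -cardsX; apply/natr_div_bound/subset_leq_card; exact: bedge_sub.
Qed.

Lemma dens3_bound (R : realType) (H : graph3) (X Y Z : {set H}) : 0 <= dens3 R X Y Z <= 1.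
Proof.
by rewrite /dens3 -!natrM -!cardsX; apply/natr_div_bound/subset_leq_card/subsetIr.
Qed.

Lemma triad_homogeneous (R : realType) (k : nat) :
  exists2 s0 : R, 0 < s0 <= 1 & forall (s : R) (l : nat), 0 < s < s0 -> (0 < l)%N ->
    exists2 eta : R, 0 < eta <= 1 & exists n0 : nat,
    forall (P : graph3 -> Prop) (H : graph3) (G : triad H) (eps2 : R),
    ~ Trip P (otimes k (Ugraph k)) -> P H ->
    [/\ (n0 < #|tX G|)%N, (n0 < #|tY G|)%N & (n0 < #|tZ G|)%N] ->
    [/\ s ^+ K_exp k / l%:R <= dens2 R (bigraphXY G),
        s ^+ K_exp k / l%:R <= dens2 R (bigraphXZ G)
      & s ^+ K_exp k / l%:R <= dens2 R (bigraphYZ G)] ->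
    eps2 <= eta -> dev23 (s ^+ K_exp k) eps2 G ->
    near01 (2 * s) (dens3 R (tX G) (tY G) (tZ G)).
Proof.
have [s0 s0P tri] := triad_near01 R k; exists s0 => // s l sP l0.
have [eta /andP[eta0 eta1] [n0 {}tri]] := tri s l sP l0.
have /andP[s_gt0 _] := sP.
set e := s ^+ K_exp k in tri *; have e0 : 0 < e by rewrite exprn_gt0.
have el : 0 < e / l%:R by rewrite divr_gt0 // ltr0n.
(* The second bound forces dXY, dXZ and dYZ to be at most twice the actual densities. Their fourth
   powers then lose 16 each, and 16^3 = 4096. *)
exists (Num.min eta (e / l%:R)); first by rewrite lt_min eta0 el ge_min eta1.
exists n0 => P H G eps2 nT PH [nX nY nZ] [].
set p := dens2 R (bigraphXY G); set q := dens2 R (bigraphXZ G); set r := dens2 R (bigraphYZ G).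
move=> hp hq hr heps [dXY [dXZ [dYZ [[xy0 xz0 yz0] [[xy1 xy2] [xz1 xz2] [yz1 yz2]] hoct]]]].
have eps_eta : eps2 <= eta by apply: le_trans heps _; rewrite ge_min lexx.
have eps_el : eps2 <= e / l%:R by apply: le_trans heps _; rewrite ge_min lexx orbT.
have dle (dd c : R) : e / l%:R <= c -> `|c - dd| <= eps2 -> dd <= 2 * c.
  by rewrite ler_norml => h1 /andP[h2 h3]; clear -h1 h2 h3 eps_el; lra.
have enum_inj (A : {set H}) : injective (enum_val : 'I_#|A| -> H) by exact: enum_val_inj.
have free := fun X Y Z u v w => @Trip_otimes_free P k H X Y Z u v w nT PH.
have := tri _ _ _ (fun (x : 'I_#|tX G|) (y : 'I_#|tY G|) (z : 'I_#|tZ G|) =>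
  (enum_val x, enum_val y, enum_val z) \in oedge3 H) (tdens R G) p q r
  (fun x y => (enum_val x, enum_val y) \in tXY G)
  (fun x z => (enum_val x, enum_val z) \in tXZ G)
  (fun y z => (enum_val y, enum_val z) \in tYZ G).
rewrite -dens3_sum -dev23_sum_oct !card_ord.
have /andP[D0 D1] := dens3_bound R (tX G) (tY G) (tZ G).
have fin : dens3 R (tX G) (tY G) (tZ G) < 2 * s \/ 1 - 2 * s < dens3 R (tX G) (tY G) (tZ G) ->
    near01 (2 * s) (dens3 R (tX G) (tY G) (tZ G)).
  by rewrite /near01 !in_itv /= D0 D1 andbT => -[->|->]; rewrite ?orbT.
move=> h; apply: fin; apply: h.
- by split.
- split; first by apply: free; exact: enum_val_inj.
  + move=> a b c cinj habc; have := free _ _ _ enum_val enum_val enum_val (@enum_inj (tX G)) a b c cinj.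
    by apply=> i S m; rewrite -(habc i S m) [RHS]oedge3_rot.
  + move=> a b c cinj habc; have := free _ _ _ enum_val enum_val enum_val (@enum_inj (tY G)) a b c cinj.
    by apply=> i S m; rewrite -(habc i S m) [LHS]oedge3_rot.
- by split; rewrite ?tdens_bound //; [have /andP[_ ->] := dens2_bound R (bigraphXY G)
    | have /andP[_ ->] := dens2_bound R (bigraphXZ G)
    | have /andP[_ ->] := dens2_bound R (bigraphYZ G)]; rewrite andbT.
- have bnd (B : bigraph H) (W : R) : W <= eps2 * #|bleft B|%:R ^+ 2 * #|bright B|%:R ^+ 2 ->
      W <= eta * (#|bleft B|%:R * #|bright B|%:R) ^+ 2.
    move=> /le_trans; apply; rewrite [X in _ <= _ * X]exprMn [X in _ <= X]mulrA.
    by do 2![apply: ler_wpM2r; first exact: sqr_ge0].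
  split.
  + by rewrite -(dev2_sum_C4 _ (bigraphXY G)); exact: bnd xy2.
  + by rewrite -(dev2_sum_C4 _ (bigraphXZ G)); exact: bnd xz2.
  + by rewrite -(dev2_sum_C4 _ (bigraphYZ G)); exact: bnd yz2.
apply: le_trans hoct _.
have h4 (a b : R) : 0 < a -> a <= 2 * b -> a ^+ 4 <= 16 * b ^+ 4.
  move=> a0 ab; rewrite (_ : 16 * b ^+ 4 = (2 * b) ^+ 4); last by ring.
  by apply: lerXn2r => //; rewrite nnegrE; clear -a0 ab; lra.
have := h4 _ _ xy0 (dle _ _ hp xy1); have := h4 _ _ xz0 (dle _ _ hq xz1).
have := h4 _ _ yz0 (dle _ _ hr yz1) => y4 x4 z4.
have pos (a : R) : 0 < a -> 0 <= a ^+ 4 by move=> a0; rewrite exprn_ge0 // ltW.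
have := ler_pM (mulr_ge0 (pos _ xy0) (pos _ xz0)) (pos _ yz0)
  (ler_pM (pos _ xy0) (pos _ xz0) z4 x4) y4.
move=> /(ler_wpM2l (ltW e0)) h5.
pose W : R := (#|tX G|%:R * #|tY G|%:R * #|tZ G|%:R) ^+ 2.
have W0 : 0 <= W by rewrite sqr_ge0.
apply: le_trans (_ : e * (dXY ^+ 4 * dXZ ^+ 4 * dYZ ^+ 4) * W <= _).
  by rewrite le_eqVlt; apply/orP; left; apply/eqP; rewrite /W; ring.
apply: le_trans (ler_wpM2r W0 h5) _.
by rewrite le_eqVlt; apply/orP; left; apply/eqP; rewrite /W; ring.
Qed.

(** * Homogeneous and regular decompositions *)

Lemma le_least (R : realType) (Q Q' : nat -> Prop) :
  (forall M, Q' M -> Q M) -> (least R Q <= least R Q')%E.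
Proof. by move=> h; apply: le_ereal_inf => x [M QM ->]; exists M => //; exact: h. Qed.

Lemma dens3E (R : realType) (H : graph3) (X Y Z : {set H}) :
  dens3 R X Y Z = #|oedge3 H :&: setX (setX X Y) Z|%:R / #|setX (setX X Y) Z|%:R.
Proof. by rewrite /dens3 !cardsX !natrM. Qed.

Lemma subset_density_le (R : realType) (T : finType) (E A B : {set T}) (c d : R) :
  0 < c -> 0 <= d -> B \subset A -> c * #|A|%:R <= #|B|%:R ->
  #|E :&: A|%:R / #|A|%:R <= d -> #|E :&: B|%:R / #|B|%:R <= d / c.
Proof.
move=> c0 d0 BA cA.
have [A0|A0] := posnP #|A|.
  have : (#|B| <= 0)%N by rewrite -A0 subset_leq_card.
  by rewrite leqn0 => /eqP ->; rewrite invr0 mulr0 divr_ge0 // ltW.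
have AR : 0 < #|A|%:R :> R by rewrite ltr0n.
have BR : 0 < #|B|%:R :> R by apply: lt_le_trans cA; exact: mulr_gt0.
rewrite !ler_pdivrMr // => h.
apply: (@le_trans _ _ #|E :&: A|%:R); first by rewrite ler_nat subset_leq_card // setIS.
apply: le_trans h _; rewrite -mulrA ler_wpM2l // ler_pdivlMl //.
Qed.

Lemma codensity (R : realType) (T : finType) (E A : {set T}) : (0 < #|A|)%N ->
  #|~: E :&: A|%:R / #|A|%:R = 1 - #|E :&: A|%:R / #|A|%:R :> R.
Proof.
move=> A0; have AR : #|A|%:R != 0 :> R by rewrite pnatr_eq0 -lt0n.
apply/eqP; rewrite eq_sym subr_eq -mulrDl -natrD [E :&: A]setIC [~: E :&: A]setIC -setDE.
by rewrite addnC cardsID divff.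
Qed.

(** Subsets of relative size at least 2a span at least (2a)^3 of the triples, and 2a^4 / (2a)^3 =
    a/4 is below 2a; this is the origin of the 4 in the exponent 1/4K. Densities near 1 are treated
    through the complement. *)
Lemma near01_weakly_regular (R : realType) (a : R) (H : graph3) (X Y Z : {set H}) :
  0 < a <= 1 -> (0 < #|X|)%N -> (0 < #|Y|)%N -> (0 < #|Z|)%N ->
  near01 (2 * a ^+ 4) (dens3 R X Y Z) -> weakly_regular3 (2 * a) X Y Z.
Proof.
case/andP=> a0 a1 X0 Y0 Z0 near.
apply/forallP => X'; apply/forallP => Y'; apply/forallP => Z'; apply/implyP.
case/and5P=> sX sY sZ cX /andP[cY cZ].
have a2 : 0 < 2 * a by rewrite mulr_gt0.
have pos (A B : {set H}) : (0 < #|A|)%N -> 2 * a * #|A|%:R <= #|B|%:R -> (0 < #|B|)%N.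
  by move=> A0 AB; rewrite -(ltr0n R) (lt_le_trans _ AB) // mulr_gt0 // ltr0n.
rewrite !dens3E; move: near; rewrite dens3E.
set A := setX (setX X Y) Z; set B := setX (setX X' Y') Z'; set E := oedge3 H.
have BA : B \subset A by rewrite !setXS.
have A0 : (0 < #|A|)%N by rewrite !cardsX !muln_gt0 X0 Y0.
have B0 : (0 < #|B|)%N by rewrite !cardsX !muln_gt0 (pos X) // (pos Y) // (pos Z).
have cAB : (2 * a) ^+ 3 * #|A|%:R <= #|B|%:R.
  rewrite !cardsX !natrM.
  have -> : (2 * a) ^+ 3 * (#|X|%:R * #|Y|%:R * #|Z|%:R) =
    2 * a * #|X|%:R * (2 * a * #|Y|%:R) * (2 * a * #|Z|%:R) by ring.
  have p0 (C : {set H}) : 0 <= 2 * a * #|C|%:R by rewrite mulr_ge0 // ltW.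
  by apply: ler_pM => //; [exact: mulr_ge0|exact: ler_pM].
have c0 : 0 < (2 * a) ^+ 3 by rewrite exprn_gt0.
have d0 : 0 <= 2 * a ^+ 4 by rewrite mulr_ge0 // exprn_ge0 // ltW.
have dc : 2 * a ^+ 4 / (2 * a) ^+ 3 = a / 4 by field; rewrite gt_eqF.
have a4 : 2 * a ^+ 4 <= 2 * a.
  rewrite ler_pM2l // exprS; apply: ler_piMr; first exact: ltW.
  by apply: exprn_ile1 => //; exact: ltW.
have dpos (F C : {set H * H * H}) : 0 <= (#|F :&: C|%:R / #|C|%:R : R) by rewrite divr_ge0.
have sub (F : {set H * H * H}) : #|F :&: A|%:R / #|A|%:R <= 2 * a ^+ 4 ->
   `|#|F :&: B|%:R / #|B|%:R - #|F :&: A|%:R / #|A|%:R| <= 2 * a.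
  move=> hF; have := subset_density_le c0 d0 BA cAB hF; rewrite dc => hB.
  have := dpos F A; have := dpos F B; move: hF hB; clear -a4 a0.
  by rewrite ler_norml => *; apply/andP; split; lra.
rewrite /near01 !in_itv /= => /orP[/andP[_ hd]|/andP[hd _]].
  by apply: sub; exact: ltW.
have := sub (~: E); rewrite !codensity //.
set u := _ / _; set v := _ / _ => h.
have -> : v - u = - (1 - v - (1 - u)) by ring.
by rewrite normrN; apply: h; move: hd; rewrite -/u; clear; lra.
Qed.

Lemma homogeneous_weakly_regular (R : realType) (a : R) (H : graph3) (Q : {set {set H}}) :
  0 < a <= 1 -> partition Q [set: H] -> homogeneous (2 * a ^+ 4) Q -> weakly_regular (2 * a) Q.
Proof.
move=> ha Qpart; rewrite /homogeneous /weakly_regular => h.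
have /andP[a0 a1] := ha.
have a4 : 2 * a ^+ 4 <= 2 * a.
  rewrite ler_pM2l // exprS; apply: ler_piMr; first exact: ltW.
  by apply: exprn_ile1 => //; exact: ltW.
have n3 : 0 <= #|H|%:R ^+ 3 :> R by rewrite exprn_ge0.
apply: (@le_trans _ _ ((1 - 2 * a ^+ 4) * #|H|%:R ^+ 3)).
  by apply: ler_wpM2r => //; clear -a4; lra.
apply: le_trans h _; rewrite ler_nat subset_leq_card //; apply/subsetP => p; rewrite !inE.
have pb (x : H) : (0 < #|pblock Q x|)%N.
  apply/card_gt0P; exists x; rewrite mem_pblock.
  by have /and3P[/eqP -> _ _] := Qpart.
exact: near01_weakly_regular.
Qed.

Lemma leq_card_im (S T : finType) (A : {set S}) (f : S -> T) (B : {set T}) :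
  {in B, forall y, exists2 x, x \in A & y = f x} -> (#|B| <= #|A|)%N.
Proof.
move=> h; apply: leq_trans (leq_imset_card f A); apply: subset_leq_card.
by apply/subsetP => y /h[x xA ->]; exact: imset_f.
Qed.


(** * Exceptional pairs and vertices of a decomposition *)

Lemma sum_card_parts (V : finType) (t l : nat) (D : decomposition V t l) :
  \sum_i #|vpart D i| = #|V|.
Proof.
rewrite -cardsT (card_partition (vpart_partition D)) big_imset //= => i j _ _.
exact: vpart_inj.
Qed.

Lemma pblock_vpart (V : finType) (t l : nat) (D : decomposition V t l) i x :
  x \in vpart D i -> pblock [set vpart D i | i : 'I_t] x = vpart D i.
Proof.
move=> xi; have /and3P[_ triv _] := vpart_partition D.
by apply: def_pblock => //; exact: imset_f.
Qed.

Definition low_pairs (R : realType) (V : finType) (t l : nat) (D : decomposition V t l)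
    (e : R) : {set V * V} :=
  [set p | [exists q : 'I_t * 'I_t * 'I_l, (p \in epart D q.1.1 q.1.2 q.2) &&
    (#|epart D q.1.1 q.1.2 q.2|%:R * l%:R < e * (#|vpart D q.1.1|%:R * #|vpart D q.1.2|%:R))]].

(** Every V_i x V_j is cut into l pieces, so the pieces of density below e / l cover at most a
    fraction e of it. *)
Lemma card_low_pairs (R : realType) (V : finType) (t l : nat) (D : decomposition V t l) (e : R) :
  0 <= e -> #|low_pairs D e|%:R <= e * #|V|%:R ^+ 2.
Proof.
move=> e0.
pose c (q : 'I_t * 'I_t * 'I_l) := #|epart D q.1.1 q.1.2 q.2|%:R * l%:R < e * (#|vpart D q.1.1|%:R * #|vpart D q.1.2|%:R).
have h1 : (#|low_pairs D e| <= \sum_(q | c q) #|epart D q.1.1 q.1.2 q.2|)%N.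
  apply: (@leq_trans #|\bigcup_(q | c q) epart D q.1.1 q.1.2 q.2|).
    apply: subset_leq_card; apply/subsetP => p; rewrite inE => /existsP[q /andP[pq cq]].
    by apply/bigcupP; exists q.
  elim/big_rec2: _ => [|q m A _ h]; first by rewrite cards0.
  by apply: leq_trans (leq_card_setU _ _).1 _; rewrite leq_add2l.
apply: (@le_trans _ _ (\sum_(q | c q) #|epart D q.1.1 q.1.2 q.2|)%N%:R); first by rewrite ler_nat.
have [l0|l0] := posnP l.
  rewrite natr_sum big1 ?mulr_ge0 ?exprn_ge0 // => q _; have := ltn_ord q.2.
  by rewrite [X in (_ < X)%N]l0.
have lR : 0 < l%:R :> R by rewrite ltr0n.
rewrite -(ler_pM2r lR) natr_sum mulr_suml big_mkcond /=.
apply: (@le_trans _ _ (\sum_(q : 'I_t * 'I_t * 'I_l) e * (#|vpart D q.1.1|%:R * #|vpart D q.1.2|%:R))).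
  by apply: ler_sum => q _; case: ifP => [/ltW|_] //; rewrite !mulr_ge0.
rewrite -(pair_bigA _ (fun (q : 'I_t * 'I_t) (_ : 'I_l) => e * (#|vpart D q.1|%:R * #|vpart D q.2|%:R))) /=.
under eq_bigr => q _ do rewrite sum_const_natr card_ord mulrCA.
rewrite -(pair_bigA _ (fun i j => e * (l%:R * (#|vpart D i|%:R * #|vpart D j|%:R)))) /=.
under eq_bigr => i _ do rewrite -!mulr_sumr -natr_sum sum_card_parts.
rewrite -!mulr_sumr -mulr_suml -natr_sum sum_card_parts.
by rewrite le_eqVlt; apply/orP; left; apply/eqP; ring.
Qed.

Definition small_part_vertices (R : realType) (V : finType) (t l : nat)
    (D : decomposition V t l) (e : R) : {set V} :=
  [set x | [exists i, (x \in vpart D i) && (#|vpart D i|%:R * t%:R < e * #|V|%:R)]].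

Lemma card_small_part_vertices (R : realType) (V : finType) (t l : nat)
    (D : decomposition V t l) (e : R) :
  0 <= e -> #|small_part_vertices D e|%:R <= e * #|V|%:R.
Proof.
move=> e0.
pose c (i : 'I_t) := #|vpart D i|%:R * t%:R < e * #|V|%:R.
have h1 : (#|small_part_vertices D e| <= \sum_(i | c i) #|vpart D i|)%N.
  apply: (@leq_trans #|\bigcup_(i | c i) vpart D i|).
    apply: subset_leq_card; apply/subsetP => x; rewrite inE => /existsP[i /andP[xi ci]].
    by apply/bigcupP; exists i.
  elim/big_rec2: _ => [|i m A _ h]; first by rewrite cards0.
  by apply: leq_trans (leq_card_setU _ _).1 _; rewrite leq_add2l.
apply: (@le_trans _ _ (\sum_(i | c i) #|vpart D i|)%N%:R); first by rewrite ler_nat.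
have [t0|t0] := posnP t.
  rewrite natr_sum big1 ?mulr_ge0 // => i _; have := ltn_ord i.
  by rewrite [X in (_ < X)%N]t0.
have tR : 0 < t%:R :> R by rewrite ltr0n.
rewrite -(ler_pM2r tR) natr_sum mulr_suml big_mkcond /=.
apply: (@le_trans _ _ (\sum_(i : 'I_t) e * #|V|%:R)).
  by apply: ler_sum => i _; case: ifP => [/ltW|_] //; rewrite mulr_ge0.
by rewrite sum_const_natr card_ord mulrC.
Qed.

(** The 7 counts the exceptional sets, each of at most e |H|^3 triples: triples in no regular triad,
    three sets with a pair in a sparse bigraph, and three with a vertex in a small part. Any other
    triple lies in a regular triad with dense bigraphs and large parts. *)
Lemma decomposition_homogeneous (R : realType) (H : graph3) (t l n0 : nat)
    (D : decomposition H t l) (e eps2 c : R) :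
  0 < e -> 7 * e <= c -> (n0 * t)%:R < e * #|H|%:R ->
  (forall G : triad H, (0 < l)%N -> [/\ (n0 < #|tX G|)%N, (n0 < #|tY G|)%N & (n0 < #|tZ G|)%N] ->
    [/\ e / l%:R <= dens2 R (bigraphXY G), e / l%:R <= dens2 R (bigraphXZ G)
      & e / l%:R <= dens2 R (bigraphYZ G)] -> dev23 e eps2 G ->
    near01 c (dens3 R (tX G) (tY G) (tZ G))) ->
  regular_triples e eps2 D -> homogeneous c [set vpart D i | i : 'I_t].
Proof.
move=> e0 ec nt good reg; rewrite /homogeneous.
set Q := [set vpart D i | i : 'I_t].
set Good := [set p | _].
set n : R := #|H|%:R.
have nn : 0 <= n by rewrite /n.
have cardG : #|Good|%:R = n ^+ 3 - #|~: Good|%:R :> R.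
  apply/eqP; rewrite eq_sym subr_eq -natrD cardsC !card_prod /n !natrM; apply/eqP; ring.
rewrite cardG mulrBl mul1r lerB //.
set L := low_pairs D e; set S := small_part_vertices D e.
pose B1 := ~: [set p : H * H * H | `[< exists i j k a b c,
            p \in K3 (dtriad D i j k a b c) /\ dev23 e eps2 (dtriad D i j k a b c) >]].
pose B2 := [set p : H * H * H | (p.1.1, p.1.2) \in L].
pose B3 := [set p : H * H * H | (p.1.1, p.2) \in L].
pose B4 := [set p : H * H * H | (p.1.2, p.2) \in L].
pose B5 := [set p : H * H * H | p.1.1 \in S].
pose B6 := [set p : H * H * H | p.1.2 \in S].
pose B7 := [set p : H * H * H | p.2 \in S].
have hB1 : #|B1|%:R <= e * n ^+ 3 by exact: reg.
have le2 (B : {set H * H * H}) : (#|B| <= #|L| * #|H|)%N -> #|B|%:R <= e * n ^+ 3.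
  rewrite -(ler_nat R) natrM => /le_trans; apply.
  have := ler_wpM2r nn (card_low_pairs D (ltW e0)).
  by rewrite -/n -/L; move/le_trans; apply; rewrite -mulrA -exprSr.
have le1 (B : {set H * H * H}) : (#|B| <= #|S| * (#|H| * #|H|))%N -> #|B|%:R <= e * n ^+ 3.
  rewrite -(ler_nat R) !natrM => /le_trans; apply.
  have := ler_wpM2r (mulr_ge0 nn nn) (card_small_part_vertices D (ltW e0)).
  by rewrite -/n -/S; move/le_trans; apply; rewrite -mulrA -expr2 -exprS.
have cX (A B : finType) (C : {set A}) : (#|C| * #|B| = #|setX C [set: B]|)%N.
  by rewrite cardsX cardsT.
have hB2 : #|B2|%:R <= e * n ^+ 3.
  apply: le2; rewrite cX; apply: (leq_card_im (f := id)) => -[[x y] z]; rewrite inE /= => h.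
  by exists (x, y, z); rewrite // in_setX h in_setT.
have hB3 : #|B3|%:R <= e * n ^+ 3.
  apply: le2; rewrite cX; apply: (leq_card_im (f := fun q : H * H * H => (q.1.1, q.2, q.1.2))).
  by move=> -[[x y] z]; rewrite inE /= => h; exists (x, z, y); rewrite // in_setX h in_setT.
have hB4 : #|B4|%:R <= e * n ^+ 3.
  apply: le2; rewrite cX; apply: (leq_card_im (f := fun q : H * H * H => (q.2, q.1.1, q.1.2))).
  by move=> -[[x y] z]; rewrite inE /= => h; exists (y, z, x); rewrite // in_setX h in_setT.
have hB5 : #|B5|%:R <= e * n ^+ 3.
  apply: le1; rewrite -card_prod cX; apply: (leq_card_im (f := fun q : H * (H * H) => (q.1, q.2.1, q.2.2))).
  by move=> -[[x y] z]; rewrite inE /= => h; exists (x, (y, z)); rewrite // in_setX h in_setT.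
have hB6 : #|B6|%:R <= e * n ^+ 3.
  apply: le1; rewrite -card_prod cX; apply: (leq_card_im (f := fun q : H * (H * H) => (q.2.1, q.1, q.2.2))).
  by move=> -[[x y] z]; rewrite inE /= => h; exists (y, (x, z)); rewrite // in_setX h in_setT.
have hB7 : #|B7|%:R <= e * n ^+ 3.
  apply: le1; rewrite -card_prod cX; apply: (leq_card_im (f := fun q : H * (H * H) => (q.2.1, q.2.2, q.1))).
  by move=> -[[x y] z]; rewrite inE /= => h; exists (z, (x, y)); rewrite // in_setX h in_setT.
have cov : ~: Good \subset B1 :|: B2 :|: B3 :|: B4 :|: B5 :|: B6 :|: B7.
  apply/subsetP => p; rewrite in_setC; apply: contraR.
  rewrite !in_setU !negb_or => /andP[/andP[/andP[/andP[/andP[/andP[b1 b2] b3] b4] b5] b6] b7].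
  move: b1; rewrite in_setC negbK inE => /asboolP[i [j [k [a [b [d [pK dev]]]]]]].
  move: pK b2 b3 b4 b5 b6 b7; rewrite !inE /= => /and3P[xy xz yz].
  have /setXP[xi yj] := subsetP (epart_sub D i j a) _ xy.
  have /setXP[_ zk] := subsetP (epart_sub D i k b) _ xz.
  move=> lxy lxz lyz sx sy sz.
  have l0 : (0 < l)%N by apply: leq_ltn_trans (ltn_ord a).
  have t0 : (0 < t)%N by apply: leq_ltn_trans (ltn_ord i).
  have tR : 0 < t%:R :> R by rewrite ltr0n.
  have lR : 0 < l%:R :> R by rewrite ltr0n.
  rewrite (pblock_vpart xi) (pblock_vpart yj) (pblock_vpart zk).
  have big (x : H) i' : x \in vpart D i' ->
      ~~ [exists i, (x \in vpart D i) && (#|vpart D i|%:R * t%:R < e * #|H|%:R)] -> (n0 < #|vpart D i'|)%N.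
    move=> xi'; rewrite negb_exists => /forallP/(_ i'); rewrite xi' /= -leNgt => /(lt_le_trans nt).
    by rewrite natrM ltr_pM2r // ltr_nat.
  have dns (x y : H) i' j' a' : (x, y) \in epart D i' j' a' -> x \in vpart D i' -> y \in vpart D j' ->
      ~~ [exists q : 'I_t * 'I_t * 'I_l, ((x, y) \in epart D q.1.1 q.1.2 q.2) &&
      (#|epart D q.1.1 q.1.2 q.2|%:R * l%:R < e * (#|vpart D q.1.1|%:R * #|vpart D q.1.2|%:R))] ->
      e / l%:R <= dens2 R (dbigraph D i' j' a').
    move=> xya xi' yj'; rewrite negb_exists => /forallP/(_ (i', j', a')); rewrite /= xya /= -leNgt => h.
    rewrite /dens2 /= ler_pdivlMr; last by rewrite mulr_gt0 // ltr0n; apply/card_gt0P; [exists x|exists y].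
    by rewrite mulrAC ler_pdivrMr.
  apply: (good (dtriad D i j k a b d)) => //.
    by split; [apply: big xi sx|apply: big yj sy|apply: big zk sz].
  split; [exact: dns xy xi yj lxy|exact: dns xz xi zk lxz|exact: dns yz yj zk lyz].
have cardU (A B : {set H * H * H}) (u v : R) : #|A|%:R <= u -> #|B|%:R <= v -> #|A :|: B|%:R <= u + v.
  move=> hA hB; apply: le_trans (lerD hA hB); rewrite -natrD ler_nat; exact: (leq_card_setU A B).1.
have := cardU _ _ _ _ (cardU _ _ _ _ (cardU _ _ _ _ (cardU _ _ _ _ (cardU _ _ _ _ (cardU _ _ _ _ hB1 hB2) hB3) hB4) hB5) hB6) hB7.
move=> hU; apply: (@le_trans _ _ #|B1 :|: B2 :|: B3 :|: B4 :|: B5 :|: B6 :|: B7|%:R).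
  by rewrite ler_nat subset_leq_card.
apply: le_trans hU _; apply: (@le_trans _ _ (7 * e * n ^+ 3)).
  by rewrite le_eqVlt; apply/orP; left; apply/eqP; ring.
by apply: ler_wpM2r => //; exact: exprn_ge0.
Qed.

(** * Decompositions with complete bigraphs *)

Lemma complete_decomposition (V : finType) (Q : {set {set V}}) :
  partition Q [set: V] ->
  exists D : decomposition V #|Q| 1,
    (forall i, vpart D i = enum_val i) /\
    (forall i j a, epart D i j a = setX (enum_val i) (enum_val j)).
Proof.
move=> Qpart.
have QE : [set enum_val i | i : 'I_#|Q|] = Q.
  apply/setP => A; apply/imsetP/idP => [[i _ ->]|AQ]; first exact: enum_valP.
  by exists (enum_rank_in AQ A); rewrite ?enum_rankK_in.
have part : partition [set enum_val i | i : 'I_#|Q|] [set: V] by rewrite QE.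
pose ep (i j : 'I_#|Q|) (a : 'I_1) := setX (enum_val i : {set V}) (enum_val j).
have disj i j (a b : 'I_1) : a != b -> [disjoint ep i j a & ep i j b] by rewrite !ord1 eqxx.
have cover i j : \bigcup_(a < 1) ep i j a = setX (enum_val i) (enum_val j) by rewrite big_ord1.
by exists (Decomposition (@enum_val_inj _ _) part disj cover).
Qed.

Lemma dev2_wrt_complete (R : realType) (V : finType) (B : bigraph V) (eps : R) :
  0 <= eps -> bedge B = setX (bleft B) (bright B) -> (0 < #|bleft B|)%N -> (0 < #|bright B|)%N ->
  dens2 R B = 1 /\ dev2_wrt eps 1 B.
Proof.
move=> e0 full X0 Y0.
have d1 : dens2 R B = 1.
  by rewrite /dens2 full cardsX natrM divff // -natrM pnatr_eq0 muln_eq0 negb_or -!lt0n X0.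
split=> //; rewrite /dev2_wrt d1 subrr normr0; split=> //.
(* At density 1 the balanced function of a complete bigraph vanishes; writing it as [0 * 0] brings
   it under [C4_scale]. *)
rewrite dev2_sum_C4 d1 (@eq_C4 _ _ _ _ (fun _ _ => 0 * 0)).
  by rewrite (C4_scale 0 (fun _ _ => 0)) expr0n mul0r !mulr_ge0 // exprn_ge0.
by move=> x y; rewrite full in_setX !enum_valP /= subrr mul0r.
Qed.

(** Seven of the eight factors are bounded by 1, which frees three of the six variables. *)
Lemma oct_le_sum (R : realFieldType) (X Y Z : finType) (F : X -> Y -> Z -> R) :
  (forall x y z, `|F x y z| <= 1) ->
  oct F <= (\sum_z \sum_x \sum_y `|F x y z|) * (#|X|%:R * #|Y|%:R * #|Z|%:R).
Proof.
move=> F1.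
pose G x0 (x1 : X) y0 (y1 : Y) z0 (z1 : Z) := `|F x0 y0 z0|.
apply: (@le_trans _ _ (\sum_x0 \sum_x1 \sum_y0 \sum_y1 \sum_z0 \sum_z1 G x0 x1 y0 y1 z0 z1)).
  rewrite octE_nested; do 6![apply: ler_sum => ? _]; apply: le_trans (ler_norm _) _.
  rewrite -!mulrA normrM ler_piMr //.
  by do !apply: norm_mul_le1.
rewrite /G.
under eq_bigr => x0 _ do under eq_bigr => x1 _ do under eq_bigr => y0 _ do under eq_bigr => y1 _ do
  under eq_bigr => z0 _ do rewrite sum_const_natr.
under eq_bigr => x0 _ do under eq_bigr => x1 _ do under eq_bigr => y0 _ do rewrite sum_const_natr -mulr_sumr.
under eq_bigr => x0 _ do rewrite sum_const_natr -!mulr_sumr.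
rewrite -!mulr_sumr.
under eq_bigr => x0 _ do rewrite exchange_big.
rewrite exchange_big le_eqVlt; apply/orP; left; apply/eqP; ring.
Qed.

Lemma sum_norm_sub_density (R : realFieldType) (T : finType) (P : pred T) (d : R) :
  (0 < #|T|)%N -> 0 <= d <= 1 -> d = (\sum_t (P t)%:R) / #|T|%:R ->
  \sum_t `|(P t)%:R - d| = 2 * (d * (1 - d)) * #|T|%:R.
Proof.
move=> T0 /andP[d0 d1] dE.
have TR : #|T|%:R != 0 :> R by rewrite pnatr_eq0 -lt0n.
have sE : \sum_t (P t)%:R = d * #|T|%:R by rewrite dE divfK.
have -> : \sum_t `|(P t)%:R - d| = (1 - 2 * d) * (\sum_t (P t)%:R) + #|T|%:R * d.
  rewrite mulr_sumr -sum_const_natr -big_split; apply: eq_bigr => t _ /=.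
  case: (P t) => /=; first by rewrite ger0_norm; [ring|lra].
  by rewrite sub0r normrN ger0_norm //; ring.
by rewrite sE; ring.
Qed.

(** The mean of |f - d| is 2 d (1 - d) when d is the density of f, and d (1 - d) < eps1/6 for d
    within eps1/6 of 0 or 1. The octahedral sum is thus at most eps1/3 of the volume squared. *)
Lemma complete_triad_dev23 (R : realType) (H : graph3) (G : triad H) (eps1 eps2 : R) :
  0 <= eps2 ->
  [/\ (0 < #|tX G|)%N, (0 < #|tY G|)%N & (0 < #|tZ G|)%N] ->
  [/\ tXY G = setX (tX G) (tY G), tXZ G = setX (tX G) (tZ G) & tYZ G = setX (tY G) (tZ G)] ->
  near01 (eps1 / 6) (dens3 R (tX G) (tY G) (tZ G)) -> dev23 eps1 eps2 G.
Proof.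
move=> e2 [X0 Y0 Z0] [XY XZ YZ] near.
have [_ dXY] := @dev2_wrt_complete R _ (bigraphXY G) _ e2 XY X0 Y0.
have [_ dXZ] := @dev2_wrt_complete R _ (bigraphXZ G) _ e2 XZ X0 Z0.
have [_ dYZ] := @dev2_wrt_complete R _ (bigraphYZ G) _ e2 YZ Y0 Z0.
exists 1, 1, 1; split=> //; rewrite !expr1n !mulr1 dev23_sum_oct.
have K3E : K3 G = setX (setX (tX G) (tY G)) (tZ G).
  apply/setP => -[[x y] z]; rewrite !inE /= XY XZ YZ !in_setX.
  by case: (x \in tX G); case: (y \in tY G); case: (z \in tZ G).
have tE : tdens R G = dens3 R (tX G) (tY G) (tZ G) by rewrite /tdens K3E dens3E.
set d := dens3 _ _ _ _ in near tE.
have hd : 0 <= d <= 1 by exact: dens3_bound.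
have dd : d * (1 - d) <= eps1 / 6.
  have /andP[d0 d1] := hd.
  move: near; rewrite /near01 !in_itv /= => /orP[/andP[_ h]|/andP[h _]].
    by apply: le_trans (ltW h); apply: ler_piMr => //; clear -d0; lra.
  apply: (@le_trans _ _ (1 - d)); last by clear -h; lra.
  by apply: ler_piMl => //; clear -d1; lra.
pose F (x : 'I_#|tX G|) (y : 'I_#|tY G|) (z : 'I_#|tZ G|) : R :=
  ((enum_val x, enum_val y, enum_val z) \in oedge3 H)%:R - d.
rewrite (@eq_oct _ _ _ _ _ F); last first.
  by move=> x y z; rewrite XY XZ YZ !in_setX !enum_valP /= mulr1 tE.
apply: le_trans (oct_le_sum _) _; first by move=> x y z; exact: norm_sub_le1.
rewrite !card_ord.
pose V : R := #|tX G|%:R * #|tY G|%:R * #|tZ G|%:R.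
have V0 : 0 <= V by rewrite !mulr_ge0.
have -> : \sum_z \sum_x \sum_y `|F x y z| = 2 * (d * (1 - d)) * V.
  pose T := ('I_#|tZ G| * ('I_#|tX G| * 'I_#|tY G|))%type.
  pose PT (q : T) := (enum_val q.2.1, enum_val q.2.2, enum_val q.1) \in oedge3 H.
  have cT : #|{: T}|%:R = V :> R.
    by rewrite !card_prod !card_ord !natrM /V mulrC.
  have -> : \sum_z \sum_x \sum_y `|F x y z| = \sum_(q : T) `|(PT q)%:R - d|.
    by under eq_bigr => z _ do rewrite pair_big; rewrite pair_big.
  rewrite (@sum_norm_sub_density _ T) ?cT //.
    by rewrite !card_prod !card_ord !muln_gt0 X0 Y0 Z0.
  rewrite /d dens3_sum !card_ord -/V; congr (_ / _).
  by under eq_bigr => z _ do rewrite pair_big; rewrite pair_big.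
rewrite -/V; have -> : eps1 * #|tX G|%:R ^+ 2 * #|tY G|%:R ^+ 2 * #|tZ G|%:R ^+ 2 = eps1 * (V * V).
  by rewrite /V; ring.
rewrite -[X in X <= _]mulrA; apply: ler_wpM2r; first exact: mulr_ge0.
have /andP[d0 d1] := hd.
have : 0 <= d * (1 - d) by rewrite mulr_ge0 // subr_ge0.
by move: dd; clear; lra.
Qed.

Lemma homogeneous_regular (R : realType) (H : graph3) (Q : {set {set H}}) (eps1 eps2 : R) :
  0 < eps1 -> 0 <= eps2 -> partition Q [set: H] -> homogeneous (eps1 / 6) Q ->
  exists D : decomposition H #|Q| 1, regular_pairs eps1 eps2 D /\ regular_triples eps1 eps2 D.
Proof.
move=> e1 e2 Qpart hom.
have [D [vE eE]] := complete_decomposition Qpart; exists D.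
have part0 i : (0 < #|vpart D i|)%N.
  rewrite card_gt0 vE; apply/eqP => v0; have := enum_valP i; rewrite v0.
  by have /and3P[_ _ /negP] := Qpart.
have idx (x : H) : exists2 i, x \in vpart D i & vpart D i = pblock Q x.
  have xQ : x \in cover Q by have /and3P[/eqP -> _ _] := Qpart; rewrite inE.
  have BQ := pblock_mem xQ; exists (enum_rank_in BQ (pblock Q x)); rewrite vE enum_rankK_in //.
  by rewrite mem_pblock.
split.
  rewrite /regular_pairs (_ : [set p | _] = setT) => [|].
    by rewrite cardsT card_prod natrM -expr2 ler_piMl ?sqr_ge0 //; clear -e1; lra.
  apply/setP => -[x y]; rewrite !inE; apply/asboolP.
  have [i xi _] := idx x; have [j yj _] := idx y; exists i, j, ord0; split.
    by rewrite eE -!vE in_setX xi yj.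
  have full : bedge (dbigraph D i j ord0) = setX (vpart D i) (vpart D j) by rewrite /= eE -!vE.
  have [d1 dev] := dev2_wrt_complete e2 full (part0 i) (part0 j).
  by rewrite /dev2 d1.
rewrite /regular_triples; set Good := [set p | _].
apply: (@le_trans _ _ (eps1 / 6 * #|H|%:R ^+ 3)); last first.
  by apply: ler_wpM2r; [exact: exprn_ge0|clear -e1; lra].
move: hom; rewrite /homogeneous mulrBl mul1r; set N := [set p | _] => hom.
have : #|N|%:R <= #|Good|%:R :> R.
  rewrite ler_nat subset_leq_card //; apply/subsetP => -[[x y] z]; rewrite !inE /= => near.
  have [i xi iE] := idx x; have [j yj jE] := idx y; have [k zk kE] := idx z.
  apply/asboolP; exists i, j, k, ord0, ord0, ord0; split.
    by rewrite inE /= !eE -!vE !in_setX xi yj zk.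
  by apply: complete_triad_dev23 => //=; rewrite ?eE -?vE ?iE ?jE ?kE // -?iE -?jE -?kE; split.
have : #|Good|%:R + #|~: Good|%:R = #|H|%:R ^+ 3 :> R.
  by rewrite -natrD cardsC !card_prod !natrM; ring.
by move: hom; clear; lra.
Qed.

Theorem theorem4p5 (R : realType) (k : nat) (hk : (1 <= k)%N) :
  exists K : nat, (1 <= K)%N /\
    forall P : graph3 -> Prop, hereditary P -> ~ Trip P (otimes k (Ugraph k)) ->
      asymptotically (fun (eps1 : R) (eps2 : nat -> R) =>
        [/\ (Mweak P (2 * eps1 `^ (1 / (4 * K%:R))) <= Mhom P (2 * eps1 `^ (1 / K%:R)))%E,
            (Mhom P (2 * eps1 `^ (1 / K%:R)) <= Tdev23 P eps1 eps2)%E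
          & (Tdev23 P eps1 eps2 <= Mhom P (eps1 / 6))%E]).
Proof.
exists (K_exp k); have K2 : (2 <= K_exp k)%N by rewrite /K_exp; lia.
set K := K_exp k in K2 *; split=> [|P _ nT]; first exact: ltnW.
have [s0 /andP[s0_gt0 s0_le1] tri] := triad_homogeneous R k.
(* The bound 1/7 makes room for the seven exceptional sets: K >= 2 gives e <= s^2, hence 7 e <= s.
   The threshold on e is [s1 ^+ K] because s is the K-th root of e. *)
pose s1 : R := Num.min s0 (1 / 7).
have s1_gt0 : 0 < s1 by rewrite lt_min s0_gt0 divr_gt0.
exists (s1 ^+ K); first by rewrite exprn_gt0.
move=> e /andP[e0 eK].
pose s : R := e `^ (1 / K%:R); pose a : R := e `^ (1 / (4 * K%:R)).
have KR : K%:R != 0 :> R by rewrite pnatr_eq0 -lt0n ltnW.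
have s_gt0 : 0 < s by exact: powR_gt0.
have sK : s ^+ K = e.
  by rewrite -powR_mulrn ?ltW // -powRrM mul1r mulVf // powRr1 // ltW.
have a_gt0 : 0 < a by exact: powR_gt0.
have a4 : a ^+ 4 = s.
  rewrite -powR_mulrn ?ltW // -powRrM; congr (_ `^ _); field; exact: KR.
have ss1 : s < s1.
  by move: eK; rewrite -sK ltr_pXn2r // ?nnegrE ?ltW // ltnW.
have ss0 : 0 < s < s0 by rewrite s_gt0 (lt_le_trans ss1) // ge_min lexx.
have s7 : 7 * s < 1.
  have : s < 1 / 7 by apply: lt_le_trans ss1 _; rewrite ge_min lexx orbT.
  by clear; lra.
have a1 : a <= 1.
  rewrite -(@ler_pXn2r _ 4) ?nnegrE ?ltW // a4 expr1n; move: s7 s_gt0; clear; lra.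
have e7 : 7 * e <= 2 * s.
  have : e <= s * s.
    rewrite -sK -(subnK K2) exprD expr2; apply: ler_piMl; first by rewrite mulr_ge0 // ltW.
    by apply: exprn_ile1; [exact: ltW|move: s7 s_gt0; clear; lra].
  have : s * (7 * s) <= s * 1 by rewrite ler_pM2l // ltW.
  by move: s_gt0; clear; lra.
pose good (l : nat) (eta : R) (n0 : nat) := (0 < l)%N ->
  forall (H : graph3) (G : triad H) (eps2 : R), P H ->
    [/\ (n0 < #|tX G|)%N, (n0 < #|tY G|)%N & (n0 < #|tZ G|)%N] ->
    [/\ e / l%:R <= dens2 R (bigraphXY G), e / l%:R <= dens2 R (bigraphXZ G)
      & e / l%:R <= dens2 R (bigraphYZ G)] ->
    eps2 <= eta -> dev23 e eps2 G -> near01 (2 * s) (dens3 R (tX G) (tY G) (tZ G)).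
have : forall l, exists eta, 0 < eta <= 1 /\ exists n0, good l eta n0.
  (* For l = 0 there are no bigraphs, [good] is vacuous, and any admissible [eta] will do. *)
  case=> [|l]; first by exists 1; rewrite ltr01 lexx; split=> //; exists 0%N.
  have [eta eta01 [n0 h]] := tri s l.+1 ss0 isT; exists eta; split=> //; exists n0 => _ H G eps2 PH.
  by rewrite -sK; exact: h P H G eps2 nT PH.
case/choice=> eta etaP.
exists eta => [l|eps2 eps2P eps2_le]; first by case: (etaP l).
split.
- apply: le_least => M [n0 h]; exists n0 => H PH nH; have [Q [Qp QM hom]] := h H PH nH.
  exists Q; split=> //; apply: homogeneous_weakly_regular => //; first by rewrite a_gt0.
  by rewrite a4.
- have [n0 n0P] := choice (fun l => (etaP l).2).
  apply: le_least => M [L [N h]].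
  (* The value of l varies with [H] but stays at most L, so one threshold serves all. Once m M < e
     |H|, a part of size at least e |H| / t has more than [n0 l] vertices. *)
  pose m := \max_(l < L.+1) n0 l.
  exists (maxn N (Num.trunc ((m * M)%:R / e)).+1) => H PH; rewrite geq_max => /andP[nN nm].
  have [t [l [tM lL [D [_ reg]]]]] := h H PH nN.
  exists [set vpart D i | i : 'I_t]; split; first exact: vpart_partition.
    by apply: leq_trans (leq_imset_card _ _) _; rewrite card_ord.
  apply: (@decomposition_homogeneous R H t l (n0 l) D e (eps2 l)) => //.
    have : (m * M)%:R / e < #|H|%:R.
      by apply: lt_le_trans (truncnS_gt _) _; rewrite ler_nat.
    rewrite ltr_pdivrMr // mulrC; apply: le_lt_trans; rewrite ler_nat leq_mul //.
    exact: (@leq_bigmax _ (fun l : 'I_L.+1 => n0 l) (Ordinal (lL : (l < L.+1)%N))).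
  by move=> G l0 nG dG; apply: (n0P l l0 H G (eps2 l) PH nG dG).
apply: le_least => M [n0 h]; exists 1%N, n0 => H PH nH; have [Q [Qp QM hom]] := h H PH nH.
exists #|Q|, 1%N; split=> //.
by apply: homogeneous_regular => //; have /andP[/ltW] := eps2P 1%N.
Qed.
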